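(* Let $F$ be a free group of rank $n$, and let $\mathcal{A}=\mathrm{Aut}(F)$ with its Andreadakis filtration $(\mathcal A[k])_{k\ge0}$ and $\mathcal{IA}=\mathcal A[1]$. The natural homomorphism $$\Upsilon_k\otimes_{\mathbb Z}\mathbb Q:\ (\Gamma_k\mathcal{IA}/\Gamma_{k+1}\mathcal{IA})\otimes_{\mathbb Z}\mathbb Q\longrightarrow(\mathcal A[k]/\mathcal A[k+1])\otimes_{\mathbb Z}\mathbb Q$$ induced by the inclusion $\Gamma_k\mathcal{IA}\subset\mathcal A[k]$ is surjective for all $k\ge1$ and $n\ge k+2$. In particular, the graded Lie algebra $\bigoplus_{k=1}^\infty\frac{\mathcal A[k]}{\mathcal A[k+1]}\otimes_{\mathbb Z}\mathbb Q$ is stably generated by its degree $1$ part (i.e. for any $k\ge1$, its degree $k$ part is generated by the degree $1$ part as soon as $n\ge k+2$).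
   Context: $\Gamma_1G=G$, $\Gamma_kG=[\Gamma_{k-1}G,G]$ is the lower central series of a group $G$. For $k\ge1$, $\mathcal A[k]$ is the subgroup of all $f\in\mathcal A$ such that $f(x)x^{-1}\in\Gamma_{k+1}F$ for all $x\in F$ (and $\mathcal A[0]=\mathcal A$). In particular $\mathcal{IA}=\mathcal A[1]$ is the subgroup acting trivially on $F/[F,F]$. One has $[\mathcal A[k],\mathcal A[\ell]]\subset\mathcal A[k+\ell]$ for $k,\ell\ge 1$, hence $\Gamma_k\mathcal{IA}\subset\mathcal A[k]$ for $k\ge 1$. The Lie bracket on the graded group $\bigoplus_k\mathcal A[k]/\mathcal A[k+1]$ is induced by group commutators. *)

(* Defs.v *)
From HB Require Import structures.
From mathcomp Require Import all_boot all_order all_algebra.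
From mathcomp Require Import mathcomp_extra boolp classical_sets functions.
From mathcomp Require Import cardinality fsbigop.

Set Implicit Arguments.
Unset Strict Implicit.
Unset Printing Implicit Defensive.

Import GRing.Theory.
Local Open Scope group_scope.
Local Open Scope quotient_scope.
Local Open Scope classical_set_scope.

Record degree := Degree { deg :> nat; deg_gt0 : (0 < deg)%N }.
HB.instance Definition _ := [isSub for deg].
HB.instance Definition _ := [Choice of degree by <:].

Definition deg1 : degree := @Degree 1 isT.
Lemma addd_subproof (i j : degree) : (0 < i + j)%N.
Proof. by rewrite addn_gt0 deg_gt0. Qed.
Definition addd (i j : degree) : degree := Degree (addd_subproof i j).

Section Subgroups.
Variable G : groupType.
Implicit Types (H N S A B : set G) (x y z : G).

Definition subgroup H : Prop :=
  [/\ H 1, forall x y, H x -> H y -> H (x * y) & forall x, H x -> H x^-1].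

Definition generated S : set G := smallest subgroup S.

(* The subgroup [A, B] generated by all commutators; in the library,
   [~ a, b] = a^-1 * b^-1 * a * b. *)
Definition commsub A B : set G :=
  generated [set c | exists a b, [/\ A a, B b & c = [~ a, b]]].

(* lcs H k = Gamma_k H for k >= 1: Gamma_1 H = H and
   Gamma_(k+1) H = [Gamma_k H, H].  The value lcs H 0 = H is a dummy. *)
Fixpoint lcs H (k : nat) : set G :=
  match k with
  | (_.+1 as k1).+1 => commsub (lcs H k1) H
  | _ => H
  end.
Arguments lcs : simpl never.

Lemma subgroup_setT : subgroup [set: G]. Proof. by []. Qed.

Lemma subgroup_generated S : subgroup (generated S).
Proof.
split=> [M [] [] //|x y Sx Sy M SM|x Sx M SM].
  by case: (SM) => -[_ MM _] _; apply: MM; [apply: Sx|apply: Sy].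
by case: (SM) => -[_ _ MV] _; apply: MV; apply: Sx.
Qed.

Lemma lcsSS H k : lcs H k.+2 = commsub (lcs H k.+1) H. Proof. by []. Qed.

Definition normalised N H := forall x h, N x -> H h -> N (x ^ h).

Lemma normalised_comm N H x h : subgroup N -> normalised N H ->
  N x -> H h -> N [~ x, h].
Proof.
move=> [N1 NM NV] NH Nx Hh; rewrite commgEl; apply: NM; first exact: NV.
exact: NH.
Qed.

Lemma comm_normalised N x h : subgroup N -> N x -> N [~ x, h] -> N (x ^ h).
Proof.
move=> [N1 NM NV] Nx Nc; have -> : x ^ h = x * [~ x, h] by rewrite commgEl mulVKg.
exact: NM.
Qed.

Lemma comm_generated N H S z : subgroup N -> subgroup H -> normalised N H ->
  S `<=` H -> H z -> (forall s, S s -> N [~ s, z]) ->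
  forall c, generated S c -> N [~ c, z].
Proof.
move=> [N1 NM NV] [H1 HM HV] NH SH Hz Sz c Sc.
suff: (H `&` [set c | N [~ c, z]]) c by case.
apply: Sc; split; last by move=> s Ss; split; [apply: SH|apply: Sz].
split=> [|x y [Hx Nx] [Hy Ny]|x [Hx Nx]]; split=> //=.
- by rewrite comm1g.
- exact: HM.
- have -> : [~ x * y, z] = [~ x, z] ^ y * [~ y, z].
    by rewrite /commg /conjg !invgM !mulgA !mulgK.
  by apply: NM => //; apply: NH.
- exact: HV.
- have -> : [~ x^-1, z] = ([~ x, z] ^ x^-1)^-1.
    by rewrite /commg /conjg !invgM !invgK !mulgA ?mulgK ?mulgVK.
  by apply: NV; apply: NH => //; apply: HV.
Qed.

Lemma Hall_Witt x y z :
  [~ x, y^-1, z] ^ y * [~ y, z^-1, x] ^ z * [~ z, x^-1, y] ^ x = 1.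
Proof.
pose a x y z : G := x * z * y ^ x.
suffices{x y z} hw_aux x y z: [~ x, y^-1, z] ^ y = (a x y z)^-1 * (a y z x).
  by rewrite !hw_aux; move: a {hw_aux} => a; rewrite 2!mulgA !mulgK mulVg.
by rewrite /a /commg /conjg !invgM ?invgK !mulgA ?mulgVK ?mulgK mulVg mul1g.
Qed.

Lemma three_subgroups N H x y z : subgroup N -> subgroup H ->
  normalised N H -> H x -> H y -> H z ->
  N [~ y, z^-1, x] -> N [~ z, x^-1, y] -> N [~ x, y^-1, z].
Proof.
move=> [N1 NM NV] [H1 HM HV] NH Hx Hy Hz Na Nb.
rewrite -[[~ x, y^-1, z]](conjgK y); apply: (NH); last exact: HV.
have /(canRL (mulgK _)) := Hall_Witt x y z; rewrite mul1g.
move=> /(canRL (mulgK _)) ->.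
by apply: NM; apply: NV; apply: NH.
Qed.

Section Lcs.
Variable H : set G.
Hypothesis sH : subgroup H.

Lemma lcs_facts k : [/\ subgroup (lcs H k.+1), lcs H k.+1 `<=` H &
  normalised (lcs H k.+1) H].
Proof.
case: (sH) => H1 HM HV.
elim: k => [|k [sL LH nL]].
  by split=> // x h Hx Hh; rewrite conjgE; apply: (HM); [apply: HV|apply: HM].
have sC: subgroup (lcs H k.+2) by apply: subgroup_generated.
have CL : lcs H k.+2 `<=` lcs H k.+1.
  apply: smallest_sub => // _ [a [b [La Hb ->]]].
  exact: (normalised_comm sL nL).
split=> //; first exact: subset_trans CL LH.
move=> x h Cx Hh; apply: (@comm_normalised (lcs H k.+2) x h) => //.
by apply: sub_gen_smallest; exists x, h; split=> //; apply: CL.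
Qed.

Lemma subgroup_lcs k : subgroup (lcs H k).
Proof. by case: k => [|k] //; case: (lcs_facts k). Qed.

Lemma lcs_sub k : lcs H k `<=` H.
Proof. by case: k => [|k] //; case: (lcs_facts k). Qed.

Lemma lcs_normalised k : normalised (lcs H k) H.
Proof. by case: k => [|k]; [case: (lcs_facts 0)|case: (lcs_facts k)]. Qed.

Lemma lcs_commS k x h : (0 < k)%N -> lcs H k x -> H h -> lcs H k.+1 [~ x, h].
Proof.
by case: k => // k _ Lx Hh; apply: sub_gen_smallest; exists x, h.
Qed.

Lemma lcs_decr k : lcs H k.+1 `<=` lcs H k.
Proof.
case: k => [|k] //; apply: smallest_sub; first exact: subgroup_lcs.
move=> _ [a [b [La Hb ->]]].
by apply: (@normalised_comm _ H) => //; [apply: subgroup_lcs|apply: lcs_normalised].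
Qed.

Lemma lcs_comm k l x y : (0 < k)%N -> (0 < l)%N ->
  lcs H k x -> lcs H l y -> lcs H (k + l) [~ x, y].
Proof.
case: k => // k _; case: l => // l _.
elim: l k x y => [|l IH] k x y Lx Ly; first by rewrite addn1; apply: lcs_commS.
have sN := subgroup_lcs (k.+1 + l.+2); have [_ _ NV] := sN.
have nN := @lcs_normalised (k.+1 + l.+2).
have Hx := lcs_sub Lx.
have [H1 HM HV] := sH.
rewrite -invgR; apply: NV; apply: (comm_generated sN sH nN _ Hx _ Ly).
  move=> _ [a [b [La Hb ->]]]; have Ha : H a := lcs_sub (k := l.+1) La.
  by rewrite /commg /conjg; do ![apply: (HM)|apply: (HV)|assumption].
move=> _ [b [h [Lb Hh ->]]]; rewrite -[h]invgK.
have [_ _ LV] := subgroup_lcs l.+1; have [_ _ LkV] := subgroup_lcs k.+1.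
have [_ _ LkV2] := subgroup_lcs k.+2.
apply: (three_subgroups sN sH nN) => //.
- exact: (lcs_sub (k := l.+1) Lb).
- exact: HV.
- have -> : (k.+1 + l.+2 = k.+2 + l.+1)%N by rewrite -addSnnS.
  apply: IH => //; rewrite -invgR; apply: LkV2.
  by apply: lcs_commS => //; [apply: LkV|apply: HV].
- rewrite addnS; apply: lcs_commS => //; last exact: HV.
  by apply: IH => //; apply: LV.
Qed.

End Lcs.
End Subgroups.

(* N-series (strongly central filtrations) indexed by the positive integers;
   the value at 0 is unconstrained. *)
Record nseries (G : groupType) := NSeries {
  nterm :> nat -> set G;
  nterm_subgroup : forall k, (0 < k)%N -> subgroup (nterm k);
  nterm_decr : forall k, (0 < k)%N -> nterm k.+1 `<=` nterm k;
  nterm_comm : forall k l x y, (0 < k)%N -> (0 < l)%N ->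
    nterm k x -> nterm l y -> nterm (k + l) [~ x, y] }.

Definition lcs_nseries (G : groupType) (H : set G) (sH : subgroup H) :
    nseries G :=
  NSeries (fun k _ => subgroup_lcs sH k) (fun k _ => lcs_decr sH (k := k))
          (lcs_comm sH).

Record aut (F : groupType) := Aut {
  aut_fun :> F -> F;
  aut_inv : F -> F;
  aut_funK : cancel aut_fun aut_inv;
  aut_invK : cancel aut_inv aut_fun;
  aut_morph : {morph aut_fun : x y / x * y} }.

HB.instance Definition _ (F : groupType) := gen_eqMixin (aut F).
HB.instance Definition _ (F : groupType) := gen_choiceMixin (aut F).

Section AutGroup.
Variable F : groupType.
Implicit Types f g h : aut F.

Lemma autP f g : f =1 g -> f = g.
Proof.
case: f => f f' fK f'K fM; case: g => g g' gK g'K gM /= fg.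
have {}fg : f = g by apply/funext.
subst g; have {}gf : f' = g' by apply/funext => x; rewrite -{1}[x]g'K fK.
by subst g'; congr Aut; apply: Prop_irrelevance.
Qed.

Definition aut_one : aut F :=
  @Aut F id id (fun=> erefl) (fun=> erefl) (fun _ _ => erefl).

Lemma aut_inv_morph f : {morph aut_inv f : x y / x * y}.
Proof.
by move=> x y; apply: (can_inj (aut_funK f)); rewrite aut_morph !aut_invK.
Qed.

Definition aut_invg f : aut F :=
  Aut (aut_invK f) (aut_funK f) (aut_inv_morph f).

Lemma aut_mul_morph f g : {morph f \o g : x y / x * y}.
Proof. by move=> x y; rewrite /= !aut_morph. Qed.

(* The product of Aut(F) is composition: (f * g) x = f (g x). *)
Definition aut_mul f g : aut F :=
  Aut (can_comp (aut_funK f) (aut_funK g))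
      (can_comp (aut_invK g) (aut_invK f)) (aut_mul_morph f g).

Lemma aut_mulA : associative aut_mul. Proof. by move=> *; apply: autP. Qed.
Lemma aut_mul1 : left_id aut_one aut_mul. Proof. by move=> *; apply: autP. Qed.
Lemma aut_mulr1 : right_id aut_one aut_mul.
Proof. by move=> *; apply: autP. Qed.
Lemma aut_mulV : left_inverse aut_one aut_invg aut_mul.
Proof. by move=> f; apply: autP => x /=; rewrite aut_funK. Qed.
Lemma aut_mulrV : right_inverse aut_one aut_invg aut_mul.
Proof. by move=> f; apply: autP => x /=; rewrite aut_invK. Qed.

HB.instance Definition _ :=
  isGroup.Build (aut F) aut_mulA aut_mul1 aut_mulr1 aut_mulV aut_mulrV.

Lemma autME f g x : (f * g) x = f (g x). Proof. by []. Qed.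
Lemma aut1E x : (1 : aut F) x = x. Proof. by []. Qed.

Lemma autfM f x y : f (x * y) = f x * f y. Proof. exact: aut_morph. Qed.
Lemma autf1 f : f 1 = 1.
Proof. by apply: (mulgI (f 1)); rewrite -autfM !mulg1. Qed.
Lemma autfV f x : f x^-1 = (f x)^-1.
Proof. by apply: (mulgI (f x)); rewrite -autfM !mulgV autf1. Qed.
Lemma autfR f x y : f [~ x, y] = [~ f x, f y].
Proof. by rewrite /commg /conjg !autfM !autfV. Qed.

Notation Gam := (lcs [set: F]).
Let sT := subgroup_setT F.

Lemma Gam_J k x y : Gam k x -> Gam k (x ^ y).
Proof. by move=> Gx; apply: (lcs_normalised sT). Qed.

Lemma Gam_aut f k x : Gam k x -> Gam k (f x).
Proof.
case: k => // k; elim: k x => // k IH.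
suff: Gam k.+2 `<=` (f @^-1` Gam k.+2) by apply.
have [N1 NM NV] := subgroup_lcs sT k.+2.
apply: smallest_sub; first split=> /=.
- by rewrite autf1.
- by move=> x y fx fy; rewrite /= autfM; apply: NM.
- by move=> x fx; rewrite /= autfV; apply: NV.
move=> _ [a [b [Ga _ ->]]]; rewrite /preimage /mkset autfR.
by apply: lcs_commS => //; apply: IH.
Qed.

(* The Andreadakis filtration: andre 0 is all of Aut(F), and
   andre 1 is IA(F). *)
Definition andre (k : nat) : set (aut F) :=
  [set f | forall x, lcs [set: F] k.+1 (f x * x^-1)].

Definition IA : set (aut F) := andre 1.

Lemma andre0 : andre 0 = setT. Proof. by apply/seteqP; split. Qed.

Lemma subgroup_andre k : subgroup (andre k).
Proof.
have [N1 NM NV] := subgroup_lcs sT k.+1; split=> [x|f g Af Ag x|f Af x].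
- by rewrite aut1E mulgV.
- have -> : (f * g) x * x^-1 = (f (g x) * (g x)^-1) * (g x * x^-1).
    by rewrite !mulgA mulgVK.
  by apply: NM; [apply: Af|apply: Ag].
- have /NV := Af (f^-1 x); rewrite -autME mulgV aut1E.
  by rewrite invgM invgK.
Qed.

Lemma andre_decr k : andre k.+1 `<=` andre k.
Proof. by move=> f Af x; apply: lcs_decr => //; apply: Af. Qed.

Lemma andre_lcs k m f x : (0 < m)%N ->
  andre k f -> Gam m x -> Gam (m + k) (f x * x^-1).
Proof.
case: m => // m _ Af; elim: m x => [|m IH] x Gx.
  by rewrite add1n; apply: Af.
suff: (Gam m.+2 `&` [set x | Gam (m.+2 + k) (f x * x^-1)]) x by case.
have sN := subgroup_lcs sT (m.+2 + k); have [N1 NM NV] := sN.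
have [L1 LM LV] := subgroup_lcs sT m.+2.
apply: (Gx); split.
  split; first by split=> //=; rewrite autf1 mulgV.
    move=> y z [Gy Ny] [Gz Nz]; split=> /=; first exact: LM.
    have -> : f (y * z) * (y * z)^-1 =
        (f y * y^-1) * (f z * z^-1) ^ y^-1.
      by rewrite autfM /conjg invgM invgK !mulgA mulgVK.
    by apply: NM => //; apply: Gam_J.
  move=> y [Gy Ny]; split=> /=; first exact: LV.
  have -> : f y^-1 * y^-1^-1 = ((f y * y^-1)^-1) ^ y.
    by rewrite autfV /conjg !invgM !invgK !mulgA mulVg mul1g.
  by apply: (@Gam_J (m.+2 + k)); apply: NV.
move=> _ [a [b [Ga _ ->]]]; split; first by apply: lcs_commS.
rewrite /= autfR.
have := IH a Ga; have := Af b.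
set u := f a * a^-1; set v := f b * b^-1 => Gv Gu.
have -> : f a = u * a by rewrite mulgVK.
have -> : f b = v * b by rewrite mulgVK.
have -> : [~ u * a, v * b] * [~ a, b]^-1 =
    [~ u, v * b] ^ a * ([~ a, v] ^ b) ^ [~ a, b]^-1.
  rewrite /commg /conjg !invgM !invgK !mulgA.
  by rewrite ?mulgK ?mulgVK ?mulgK ?mulgVK.
have Gu' : Gam (m.+2 + k) [~ u, v * b].
  by rewrite !addSn; apply: lcs_commS.
have Gav : Gam (m.+2 + k) [~ a, v].
  by rewrite addSnnS; apply: lcs_comm.
by apply: NM; do !apply: Gam_J.
Qed.

Lemma andre_comm k l f g : (0 < k)%N -> (0 < l)%N ->
  andre k f -> andre l g -> andre (k + l) [~ f, g].
Proof.
move=> k0 l0 Af Ag x.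
have [N1 NM NV] := subgroup_lcs sT (k + l).+1.
suff Nfg : Gam (k + l).+1 ((f * g) x * ((g * f) x)^-1).
  have -> : [~ f, g] x * x^-1 =
      ((g * f)^-1 : aut F) ((f * g) x * ((g * f) x)^-1).
    have -> : [~ f, g] = (g * f)^-1 * (f * g).
      by rewrite /commg /conjg invgM !mulgA.
    by rewrite autfM autfV -(autME _ (g * f)) mulVg aut1E autME.
  exact: Gam_aut.
rewrite !autME.
have := andre_lcs (ltn0Sn l) Af (Ag x); have := andre_lcs (ltn0Sn k) Ag (Af x).
have := Af x; have := Ag x.
set u := f x * x^-1; set v := g x * x^-1 => Gv Gu.
set u' := g u * u^-1; set v' := f v * v^-1 => Gu' Gv'.
have gx : g x = v * x by rewrite mulgVK.
have fx : f x = u * x by rewrite mulgVK.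
have fv : f v = v' * v by rewrite mulgVK.
have gu : g u = u' * u by rewrite mulgVK.
clearbody u' v'; clearbody u v.
rewrite gx fx !autfM fv gu fx gx.
have -> : v' * v * (u * x) * (u' * u * (v * x))^-1 =
    v' * [~ v^-1, u^-1] * u'^-1.
  rewrite /commg /conjg !invgM !invgK !mulgA.
  by rewrite ?mulgK ?mulgVK.
have kl : (l.+1 + k = (k + l).+1)%N by rewrite addSn addnC.
apply: (NM); last by apply: NV; rewrite -addSn.
apply: (NM); first by rewrite -kl.
apply: lcs_decr => //; rewrite -addSn -addnS addnC.
have [_ _ LV] := subgroup_lcs sT l.+1; have [_ _ LV'] := subgroup_lcs sT k.+1.
by apply: lcs_comm => //; [apply: LV|apply: LV'].
Qed.

Lemma subgroup_IA : subgroup IA. Proof. exact: subgroup_andre. Qed.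

Lemma lcs_IA_andre k : (0 < k)%N -> lcs IA k `<=` andre k.
Proof.
case: k => // k _; elim: k => // k IH.
apply: smallest_sub; first exact: subgroup_andre.
move=> _ [f [g [Lf Ag ->]]]; rewrite -addn1.
by apply: andre_comm => //; apply: IH.
Qed.

Definition andre_nseries : nseries (aut F) :=
  NSeries (fun k _ => subgroup_andre k) (fun k _ => @andre_decr k) andre_comm.

Definition IA_nseries : nseries (aut F) := lcs_nseries subgroup_IA.

End AutGroup.

(* F is free of rank n: it has a basis x_0, ..., x_(n-1), i.e. every family of n
   elements of a group H extends uniquely along x to a homomorphism F -> H. *)
Definition free_basis (F : groupType) (n : nat) (x : 'I_n -> F) : Prop :=
  forall (H : groupType) (h : 'I_n -> H),
    exists! f : F -> H, {morph f : a b / a * b} /\ (forall i, f (x i) = h i).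

Definition free_of_rank (F : groupType) (n : nat) : Prop :=
  exists x : 'I_n -> F, free_basis x.

Section GradedQuotient.
Variables (G : groupType) (A : nseries G).
Implicit Types (i j k : degree).

Lemma ntermM k x y : A k x -> A k y -> A k (x * y).
Proof. by case: (nterm_subgroup A (deg_gt0 k)) => _ + _; apply. Qed.
Lemma ntermV k x : A k x -> A k x^-1.
Proof. by case: (nterm_subgroup A (deg_gt0 k)) => _ _; apply. Qed.
Lemma nterm1 k : A k 1.
Proof. by case: (nterm_subgroup A (deg_gt0 k)). Qed.
Lemma ntermSM k x y : A k.+1 x -> A k.+1 y -> A k.+1 (x * y).
Proof. by case: (nterm_subgroup A (ltn0Sn k)) => _ + _; apply. Qed.
Lemma ntermSV k x : A k.+1 x -> A k.+1 x^-1.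
Proof. by case: (nterm_subgroup A (ltn0Sn k)) => _ _; apply. Qed.
Lemma ntermS1 k : A k.+1 1.
Proof. by case: (nterm_subgroup A (ltn0Sn k)). Qed.
Lemma ntermS k x : A k.+1 x -> A k x.
Proof. by apply: nterm_decr; apply: deg_gt0. Qed.

Lemma nterm_commS (m p q : nat) x y : (0 < p)%N -> (0 < q)%N ->
  (m <= p + q)%N -> (0 < m)%N -> A p x -> A q y -> A m [~ x, y].
Proof.
move=> p0 q0 mkl m0 Ax Ay; have := nterm_comm p0 q0 Ax Ay.
rewrite -(subnKC mkl); elim: (_ - m)%N => [|d IH]; first by rewrite addn0.
by rewrite addnS => /nterm_decr; rewrite addn_gt0 m0 => /(_ isT).
Qed.

Lemma ntermSJ k x y : A k.+1 x -> A k y -> A k.+1 (x ^ y).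
Proof.
move=> Ax Ay; have -> : x ^ y = x * [~ x, y] by rewrite commgEl mulVKg.
apply: ntermSM => //; apply: (nterm_commS _ _ _ _ Ax Ay) => //.
  exact: deg_gt0.
by rewrite leq_addr.
Qed.

(* The quotient A_k / A_(k+1), written additively. *)
Definition gr_rel k (x y : A k) : bool := `[< A k.+1 ((val x)^-1 * val y) >].

Lemma gr_rel_refl k : reflexive (@gr_rel k).
Proof. by move=> x; apply/asboolP; rewrite mulVg; apply: ntermS1. Qed.

Lemma gr_rel_sym k : symmetric (@gr_rel k).
Proof.
by move=> x y; apply/asboolP/asboolP => /ntermSV; rewrite invgM invgK.
Qed.

Lemma gr_rel_trans k : transitive (@gr_rel k).
Proof.
move=> y x z /asboolP xy /asboolP yz; apply/asboolP.
by have := ntermSM xy yz; rewrite mulgA mulgK.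
Qed.

Canonical gr_equiv k :=
  EquivRel (@gr_rel k) (@gr_rel_refl k) (@gr_rel_sym k) (@gr_rel_trans k).

Definition gr k : Type := {eq_quot (gr_equiv k)}.
HB.instance Definition _ k := Choice.on (gr k).
HB.instance Definition _ k := EqQuotient.on (gr k).

Definition nelt k x (Ax : A k x) : A k := exist _ x (mem_set Ax).

(* The class of x \in A_k in A_k / A_(k+1). *)
Definition gr_class k x (Ax : A k x) : gr k := \pi_(gr k) (nelt Ax).

Lemma gr_classP k x y (Ax : A k x) (Ay : A k y) :
  gr_class Ax = gr_class Ay <-> A k.+1 (x^-1 * y).
Proof.
split=> [/eqmodP/asboolP //|xy].
by apply/eqmodP/asboolP.
Qed.

Lemma gr_ind k (P : gr k -> Prop) :
  (forall x (Ax : A k x), P (gr_class Ax)) -> forall u, P u.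
Proof.
move=> Pc; elim/quotW => -[x xA]; have := Pc x (set_mem xA).
by rewrite /gr_class /nelt (Prop_irrelevance (mem_set _) xA).
Qed.

Definition gr_repr k (u : gr k) : G := val (repr u).
Lemma gr_reprP k (u : gr k) : A k (gr_repr u).
Proof. exact: set_valP. Qed.

Lemma gr_reprK k (u : gr k) : gr_class (gr_reprP u) = u.
Proof.
rewrite -[RHS]reprK /gr_class; congr (\pi_(gr k) _); exact: val_inj.
Qed.

Lemma gr_repr_class k x (Ax : A k x) : A k.+1 (x^-1 * gr_repr (gr_class Ax)).
Proof. by apply/(gr_classP Ax (gr_reprP _)); rewrite gr_reprK. Qed.

Definition gr_zero k : gr k := gr_class (nterm1 k).
Definition gr_opp k (u : gr k) : gr k := gr_class (ntermV (gr_reprP u)).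
Definition gr_add k (u v : gr k) : gr k :=
  gr_class (ntermM (gr_reprP u) (gr_reprP v)).

Lemma gr_addE k x y (Ax : A k x) (Ay : A k y) :
  gr_add (gr_class Ax) (gr_class Ay) = gr_class (ntermM Ax Ay).
Proof.
apply/esym/gr_classP.
set x' := gr_repr _; set y' := gr_repr _.
have -> : (x * y)^-1 * (x' * y') = (x^-1 * x') ^ y * (y^-1 * y').
  by rewrite /conjg invgM !mulgA mulgK.
by apply: ntermSM; [apply: ntermSJ => //|]; apply: gr_repr_class.
Qed.

Lemma gr_oppE k x (Ax : A k x) :
  gr_opp (gr_class Ax) = gr_class (ntermV Ax).
Proof.
apply/esym/gr_classP; set x' := gr_repr _.
have -> : x^-1^-1 * x'^-1 = (x^-1 * x')^-1 ^ x^-1.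
  by rewrite /conjg !invgM !invgK !mulgA mulgK.
by apply: ntermSJ; [apply: ntermSV; apply: gr_repr_class|apply: ntermV].
Qed.

Lemma gr_class_eq k x y (Ax : A k x) (Ay : A k y) :
  x = y -> gr_class Ax = gr_class Ay.
Proof. by move=> xy; apply/gr_classP; rewrite xy mulVg; apply: ntermS1. Qed.

Lemma gr_addA k : associative (@gr_add k).
Proof.
elim/gr_ind=> x Ax; elim/gr_ind=> y Ay; elim/gr_ind=> z Az.
by rewrite !gr_addE; apply: gr_class_eq; rewrite mulgA.
Qed.

Lemma gr_addC k : commutative (@gr_add k).
Proof.
elim/gr_ind=> x Ax; elim/gr_ind=> y Ay.
rewrite !gr_addE; apply/gr_classP.
have -> : (x * y)^-1 * (y * x) = [~ y, x].
  by rewrite /commg /conjg invgM !mulgA.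
by apply: (nterm_commS _ _ _ _ Ay Ax); rewrite ?deg_gt0 // -addn1 leq_add2l deg_gt0.
Qed.

Lemma gr_add0 k : left_id (@gr_zero k) (@gr_add k).
Proof. by elim/gr_ind=> x Ax; rewrite gr_addE; apply: gr_class_eq; rewrite mul1g. Qed.

Lemma gr_addN k : left_inverse (@gr_zero k) (@gr_opp k) (@gr_add k).
Proof.
by elim/gr_ind=> x Ax; rewrite gr_oppE gr_addE; apply: gr_class_eq; rewrite mulVg.
Qed.

HB.instance Definition _ k := GRing.isZmodule.Build (gr k)
  (@gr_addA k) (@gr_addC k) (@gr_add0 k) (@gr_addN k).

Lemma gr_classD k x y (Ax : A k x) (Ay : A k y) :
  (gr_class Ax + gr_class Ay)%R = gr_class (ntermM Ax Ay).
Proof. exact: gr_addE. Qed.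

Lemma gr_br_subproof i j (u : gr i) (v : gr j) :
  A (addd i j) [~ gr_repr u, gr_repr v].
Proof. by apply: nterm_comm; rewrite ?deg_gt0 //; apply: gr_reprP. Qed.

(* Computed on representatives; gr_brE shows that the choice is irrelevant. *)
Definition gr_br i j (u : gr i) (v : gr j) : gr (addd i j) :=
  gr_class (gr_br_subproof u v).

Lemma nterm_addd i j x y : A i x -> A j y -> A (addd i j) [~ x, y].
Proof. by move=> Ax Ay; apply: nterm_comm; rewrite ?deg_gt0. Qed.

Lemma gr_comm_l i j x x' y : A i x -> A i x' -> A j y ->
  A (addd i j).+1 (([~ x, y] * [~ x', y])^-1 * [~ x * x', y]).
Proof.
move=> Ax Ax' Ay.
have -> : [~ x * x', y] = [~ x, y] * [~ [~ x, y], x'] * [~ x', y].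
  rewrite [[~ [~ x, y], x']]commgEl mulVKg.
  by rewrite /commg /conjg !invgM !mulgA !mulgK.
rewrite invgM.
have -> a b c : b^-1 * a^-1 * (a * c * b) = c ^ b :> G.
  by rewrite /conjg !mulgA mulgVK.
have c1 : A (addd i j).+1 [~ [~ x, y], x'].
  apply: (nterm_commS _ _ _ _ (nterm_addd Ax Ay) Ax'); rewrite ?deg_gt0 //.
  by rewrite -addn1 leq_add2l deg_gt0.
have -> a b : a ^ b = a * [~ a, b] :> G by rewrite commgEl mulVKg.
apply: ntermSM => //.
apply: (nterm_commS _ _ _ _ c1 (nterm_addd Ax' Ay)); rewrite ?deg_gt0 //.
exact: leq_addr.
Qed.

Lemma gr_comm_r i j x y y' : A i x -> A j y -> A j y' ->
  A (addd i j).+1 (([~ x, y] * [~ x, y'])^-1 * [~ x, y * y']).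
Proof.
move=> Ax Ay Ay'.
have -> : [~ x, y * y'] = [~ x, y'] * ([~ x, y] * [~ [~ x, y], y']).
  rewrite [[~ [~ x, y], y']]commgEl mulVKg.
  by rewrite /commg /conjg !invgM !mulgA !mulgK.
have -> a b c : (a * b)^-1 * (b * (a * c)) = [~ b, a] * c :> G.
  by rewrite /commg /conjg invgM !mulgA.
have c1 : A (addd i j).+1 [~ [~ x, y], y'].
  apply: (nterm_commS _ _ _ _ (nterm_addd Ax Ay) Ay'); rewrite ?deg_gt0 //.
  by rewrite -addn1 leq_add2l deg_gt0.
apply: ntermSM => //.
apply: (nterm_commS _ _ _ _ (nterm_addd Ax Ay') (nterm_addd Ax Ay));
  rewrite ?deg_gt0 //.
by rewrite -addn1 leq_add2l deg_gt0.
Qed.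

Lemma gr_comm0 i j x y : A i x -> A j y ->
  A i.+1 x \/ A j.+1 y -> A (addd i j).+1 [~ x, y].
Proof.
move=> Ax Ay [Ax1|Ay1].
  by apply: (nterm_commS _ _ _ _ Ax1 Ay); rewrite ?deg_gt0.
by apply: (nterm_commS _ _ _ _ Ax Ay1); rewrite ?deg_gt0 // addnS.
Qed.

Lemma gr_brE i j x y (Ax : A i x) (Ay : A j y) :
  gr_br (gr_class Ax) (gr_class Ay) = gr_class (nterm_addd Ax Ay).
Proof.
apply/esym/gr_classP.
set x' := gr_repr _; set y' := gr_repr _.
have Ax' : A i x' by apply: gr_reprP.
have Ay' : A j y' by apply: gr_reprP.
have xx' : A i.+1 (x^-1 * x') by apply: gr_repr_class.
have yy' : A j.+1 (y^-1 * y') by apply: gr_repr_class.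
have -> : [~ x, y]^-1 * [~ x', y'] =
    ([~ x, y]^-1 * [~ x, y']) * ([~ x, y']^-1 * [~ x', y']).
  by rewrite -[RHS]mulgA mulVKg.
apply: ntermSM.
  have := gr_comm_r Ax Ay (ntermS yy').
  rewrite mulVKg invgM -mulgA => h.
  have c := gr_comm0 Ax (ntermS yy') (or_intror yy').
  by have := ntermSM c h; rewrite mulVKg.
have := gr_comm_l Ax (ntermS xx') Ay'.
rewrite mulVKg invgM -mulgA => h.
have c := gr_comm0 (ntermS xx') Ay' (or_introl xx').
by have := ntermSM c h; rewrite mulVKg.
Qed.

Lemma gr_brDl i j (u u' : gr i) (v : gr j) :
  gr_br (u + u')%R v = (gr_br u v + gr_br u' v)%R.
Proof.
move: u u' v; elim/gr_ind=> x Ax; elim/gr_ind=> x' Ax'; elim/gr_ind=> y Ay.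
rewrite gr_classD !gr_brE gr_classD; apply/esym/gr_classP.
exact: gr_comm_l.
Qed.

Lemma gr_brDr i j (u : gr i) (v v' : gr j) :
  gr_br u (v + v')%R = (gr_br u v + gr_br u v')%R.
Proof.
move: u v v'; elim/gr_ind=> x Ax; elim/gr_ind=> y Ay; elim/gr_ind=> y' Ay'.
rewrite gr_classD !gr_brE gr_classD; apply/esym/gr_classP.
exact: gr_comm_r.
Qed.

End GradedQuotient.

(* The homomorphism A_k / A_(k+1) -> B_k / B_(k+1) induced by inclusions
   A_k <= B_k. *)
Section GrIncl.
Variables (G : groupType) (A B : nseries G).
Hypothesis AB : forall k, (0 < k)%N -> A k `<=` B k.
Variable k : degree.

Definition gr_incl (u : gr A k) : gr B k :=
  gr_class (AB (deg_gt0 k) (gr_reprP u)).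

Lemma gr_inclE x (Ax : A k x) :
  gr_incl (gr_class Ax) = gr_class (AB (deg_gt0 k) Ax).
Proof. by apply/esym/gr_classP; apply: AB => //; apply: gr_repr_class. Qed.

Fact gr_incl_is_zmod_morphism : zmod_morphism gr_incl.
Proof.
have inclD u v : gr_incl (u + v)%R = (gr_incl u + gr_incl v)%R.
  move: u v; elim/gr_ind=> x Ax; elim/gr_ind=> y Ay.
  by rewrite gr_classD !gr_inclE gr_classD; apply: gr_class_eq.
by move=> u v; apply: (addIr (gr_incl v)); rewrite subrK -inclD subrK.
Qed.
HB.instance Definition _ :=
  GRing.isZmodMorphism.Build (gr A k) (gr B k) gr_incl gr_incl_is_zmod_morphism.

End GrIncl.

Local Open Scope ring_scope.

Definition biadditive (M N P : zmodType) (b : M -> N -> P) : Prop :=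
  (forall y, {morph b^~ y : x x' / x + x'}) /\
  (forall x, {morph b x : y y' / y + y'}).

(* The tensor product over Z: finite formal sums of pairs (x, y), two of which
   are identified when every biadditive map into an abelian group gives them
   the same value.  This is the quotient of the free abelian group on M x N by
   the bilinearity relations: see tens_lift below for the universal property. *)
Section Tensor.
Variables M N : zmodType.
Implicit Types (s t : seq (M * N)).

Definition tens_eval (P : zmodType) (b : M -> N -> P) s : P :=
  \sum_(p <- s) b p.1 p.2.

Definition tens_rel s t : bool :=
  `[< forall (P : zmodType) (b : M -> N -> P),
        biadditive b -> tens_eval b s = tens_eval b t >].

Lemma tens_rel_refl : reflexive tens_rel.
Proof. by move=> s; apply/asboolP. Qed.
Lemma tens_rel_sym : symmetric tens_rel.
Proof.
by move=> s t; apply/asboolP/asboolP => st P b bb; rewrite st.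
Qed.
Lemma tens_rel_trans : transitive tens_rel.
Proof.
move=> t s r /asboolP st /asboolP tr; apply/asboolP => P b bb.
by rewrite st // tr.
Qed.
Canonical tens_equiv :=
  EquivRel tens_rel tens_rel_refl tens_rel_sym tens_rel_trans.

Definition tens : Type := {eq_quot tens_equiv}.
HB.instance Definition _ := Choice.on tens.
HB.instance Definition _ := EqQuotient.on tens.

Definition tens_cl s : tens := \pi_tens s.

Lemma tens_clP s t : tens_cl s = tens_cl t <->
  forall (P : zmodType) (b : M -> N -> P), biadditive b ->
    tens_eval b s = tens_eval b t.
Proof. by split=> [/eqmodP/asboolP|st]; [|apply/eqmodP/asboolP]. Qed.

Lemma tens_reprK u : tens_cl (repr u) = u. Proof. exact: reprK. Qed.

Lemma tens_eval_repr (P : zmodType) (b : M -> N -> P) s :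
  biadditive b -> tens_eval b (repr (tens_cl s)) = tens_eval b s.
Proof.
by move=> bb; apply: (iffLR (tens_clP _ _)) => //; rewrite tens_reprK.
Qed.

Lemma tens_eval_cat (P : zmodType) (b : M -> N -> P) s t :
  tens_eval b (s ++ t) = tens_eval b s + tens_eval b t.
Proof. by rewrite /tens_eval big_cat. Qed.

Lemma biadditive0l (P : zmodType) (b : M -> N -> P) y :
  biadditive b -> b 0 y = 0.
Proof. by case=> bl _; apply: (addIr (b 0 y)); rewrite -bl !add0r. Qed.

Lemma biadditiveNl (P : zmodType) (b : M -> N -> P) x y :
  biadditive b -> b (- x) y = - b x y.
Proof.
by move=> bb; apply: (addIr (b x y)); rewrite -bb.1 !addNr biadditive0l.
Qed.

Definition tens_zero : tens := tens_cl [::].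
Definition tens_add (u v : tens) : tens := tens_cl (repr u ++ repr v).
Definition tens_opp (u : tens) : tens :=
  tens_cl [seq (- p.1, p.2) | p <- repr u].

Lemma tens_eval_opp (P : zmodType) (b : M -> N -> P) s : biadditive b ->
  tens_eval b [seq (- p.1, p.2) | p <- s] = - tens_eval b s.
Proof.
move=> bb; rewrite /tens_eval big_map -sumrN; apply: eq_bigr => p _ /=.
exact: biadditiveNl.
Qed.

Lemma tens_addE s t : tens_add (tens_cl s) (tens_cl t) = tens_cl (s ++ t).
Proof.
by apply/tens_clP => P b bb; rewrite !tens_eval_cat !tens_eval_repr.
Qed.

Lemma tens_addA : associative tens_add.
Proof.
move=> u v w; rewrite -(tens_reprK u) -(tens_reprK v) -(tens_reprK w).
by rewrite !tens_addE catA.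
Qed.
Lemma tens_addC : commutative tens_add.
Proof.
by move=> u v; apply/tens_clP => P b bb; rewrite !tens_eval_cat addrC.
Qed.
Lemma tens_add0 : left_id tens_zero tens_add.
Proof. by move=> u; rewrite -(tens_reprK u) tens_addE. Qed.
Lemma tens_addN : left_inverse tens_zero tens_opp tens_add.
Proof.
move=> u; apply/tens_clP => P b bb.
rewrite tens_eval_cat tens_eval_repr // tens_eval_opp // addNr.
by rewrite /tens_eval big_nil.
Qed.

HB.instance Definition _ :=
  GRing.isZmodule.Build tens tens_addA tens_addC tens_add0 tens_addN.

Definition tpure (x : M) (y : N) : tens := tens_cl [:: (x, y)].

Lemma tpure_biadditive : biadditive tpure.
Proof.
split=> [y x x'|x y y']; rewrite {2}/GRing.add /= tens_addE;
  apply/tens_clP => P b bb; rewrite /tens_eval big_cat !big_seq1 /=.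
  by rewrite bb.1.
by rewrite bb.2.
Qed.

Lemma tens_clE s : tens_cl s = \sum_(p <- s) tpure p.1 p.2.
Proof.
elim: s => [|[x y] s IH]; first by rewrite big_nil.
by rewrite big_cons -IH {1}/GRing.add /= tens_addE.
Qed.

Lemma tens_ind (Q : tens -> Prop) : Q 0 ->
  (forall x y, Q (tpure x y)) -> (forall u v, Q u -> Q v -> Q (u + v)) ->
  forall u, Q u.
Proof.
move=> Q0 Qp QD u; rewrite -(tens_reprK u) tens_clE.
exact: (big_ind Q).
Qed.

(* The homomorphism tens -> P sending tpure x y to b x y, for biadditive b. *)
Definition tens_lift (P : zmodType) (b : M -> N -> P) (u : tens) : P :=
  tens_eval b (repr u).

Section Lift.
Variables (P : zmodType) (b : M -> N -> P).
Hypothesis bb : biadditive b.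

Lemma tens_lift_pure x y : tens_lift b (tpure x y) = b x y.
Proof. by rewrite /tens_lift tens_eval_repr // /tens_eval big_seq1. Qed.

Lemma tens_liftD u v : tens_lift b (u + v) = tens_lift b u + tens_lift b v.
Proof.
by rewrite -tens_eval_cat; apply: (tens_eval_repr (repr u ++ repr v) bb).
Qed.

Lemma tens_lift0 : tens_lift b 0 = 0.
Proof. by apply: (addIr (tens_lift b 0)); rewrite -tens_liftD !add0r. Qed.

End Lift.

Lemma eq_tens_lift (P : zmodType) (b c : M -> N -> P) :
  (forall x y, b x y = c x y) -> tens_lift b =1 tens_lift c.
Proof. by move=> bc u; apply: eq_bigr => p _; apply: bc. Qed.

Lemma tens_lift_addb (P : zmodType) (b c : M -> N -> P) u :
  tens_lift (fun x y => b x y + c x y) u = tens_lift b u + tens_lift c u.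
Proof. by rewrite /tens_lift /tens_eval big_split. Qed.

Lemma tens_ext (P : zmodType) (f g : tens -> P) :
  {morph f : u v / u + v} -> {morph g : u v / u + v} ->
  (forall x y, f (tpure x y) = g (tpure x y)) -> f =1 g.
Proof.
have m0 (h : tens -> P) : {morph h : u v / u + v} -> h 0 = 0.
  by move=> hD; apply: (addIr (h 0)); rewrite -hD !add0r.
move=> fD gD fg; elim/tens_ind => [|//|u v fu fv]; first by rewrite !m0.
by rewrite fD gD fu fv.
Qed.

End Tensor.

Definition tensQ (M : zmodType) : Type := tens M rat.
HB.instance Definition _ (M : zmodType) := GRing.Zmodule.on (tensQ M).

Section TensQ.
Variable M : zmodType.
Implicit Types (a q : rat) (u v : tensQ M).

Definition tensQ_scale a u : tensQ M :=
  tens_lift (fun x q => tpure x (a * q)) u.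

Lemma tensQ_scale_biadd a :
  biadditive (fun (x : M) q => tpure x (a * q)).
Proof.
have [tl tr] := tpure_biadditive M rat.
by split=> [q x x'|x q q'] /=; rewrite ?tl // mulrDr tr.
Qed.

Lemma tensQ_scale_pure a x q : tensQ_scale a (tpure x q) = tpure x (a * q).
Proof. exact/tens_lift_pure/tensQ_scale_biadd. Qed.

Lemma tensQ_scaleDr : right_distributive tensQ_scale +%R.
Proof. by move=> a u v; apply/tens_liftD/tensQ_scale_biadd. Qed.

Lemma tensQ_scaleA a b u :
  tensQ_scale a (tensQ_scale b u) = tensQ_scale (a * b) u.
Proof.
move: u; apply: tens_ext => [u v|u v|x q]; rewrite ?tensQ_scaleDr //.
by rewrite !tensQ_scale_pure mulrA.
Qed.

Lemma tensQ_scale1 : left_id 1 tensQ_scale.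
Proof. by apply: tens_ext => [u v|//|x q]; rewrite ?tensQ_scaleDr // tensQ_scale_pure mul1r. Qed.

Lemma tensQ_scaleDl u : {morph tensQ_scale^~ u : a b / a + b}.
Proof.
move=> a b; move: u; apply: tens_ext => [u v|u v|x q].
- exact: tensQ_scaleDr.
- by rewrite !tensQ_scaleDr addrACA.
by rewrite !tensQ_scale_pure mulrDl (tpure_biadditive M rat).2.
Qed.

HB.instance Definition _ := GRing.Zmodule_isLmodule.Build rat (tensQ M)
  tensQ_scaleA tensQ_scale1 tensQ_scaleDr tensQ_scaleDl.

Lemma tensQ_scaleE a x q : a *: (tpure x q : tensQ M) = tpure x (a * q).
Proof. exact: tensQ_scale_pure. Qed.

End TensQ.

(* f (x) id_Q *)
Section MapQ.
Variables (M N : zmodType) (f : {additive M -> N}).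

Definition mapQ (u : tensQ M) : tensQ N :=
  tens_lift (fun x q => tpure (f x) q) u.

Lemma mapQ_biadd : biadditive (fun (x : M) (q : rat) => tpure (f x) q).
Proof.
have [tl tr] := tpure_biadditive N rat.
by split=> [q x x'|x q q'] /=; rewrite ?raddfD ?tl ?tr.
Qed.

Lemma mapQ_pure x q : mapQ (tpure x q) = tpure (f x) q.
Proof. exact/tens_lift_pure/mapQ_biadd. Qed.

Fact mapQ_is_linear : linear mapQ.
Proof.
have mD : {morph mapQ : u v / u + v} by move=> u v; exact/tens_liftD/mapQ_biadd.
move=> a u v; rewrite mD; congr (_ + _); move: u.
apply: tens_ext => [u w|u w|x q]; rewrite ?scalerDr ?mD ?scalerDr //.
by rewrite tensQ_scaleE !mapQ_pure tensQ_scaleE.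
Qed.
HB.instance Definition _ :=
  GRing.isLinear.Build rat (tensQ M) (tensQ N) _ mapQ mapQ_is_linear.

End MapQ.

(* The Q-bilinear extension of a biadditive map:
   (x (x) p, y (x) q) |-> b x y (x) pq. *)
Section BilinQ.
Variables (M N P : zmodType) (b : M -> N -> P).

Definition bilinQ (u : tensQ M) (v : tensQ N) : tensQ P :=
  tens_lift (fun x p => tens_lift (fun y q => tpure (b x y) (p * q)) v) u.

Hypothesis bb : biadditive b.

Let in_biadd x p :
  biadditive (fun (y : N) (q : rat) => tpure (b x y) (p * q)).
Proof.
have [tl tr] := tpure_biadditive P rat.
by split=> [q y y'|y q q'] /=; rewrite ?bb.2 ?mulrDr ?tl ?tr.
Qed.

Let out_biadd v : biadditive
  (fun x (p : rat) => tens_lift (fun y q => tpure (b x y) (p * q)) v).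
Proof.
have [tl tr] := tpure_biadditive P rat.
split=> [p x x'|x p p'] /=; rewrite -tens_lift_addb; apply: eq_tens_lift => y q.
  by rewrite bb.1 tl.
by rewrite mulrDl tr.
Qed.

Lemma bilinQ_pure x p y q :
  bilinQ (tpure x p) (tpure y q) = tpure (b x y) (p * q).
Proof.
by rewrite /bilinQ (tens_lift_pure (out_biadd _)) (tens_lift_pure (in_biadd _ _)).
Qed.

Lemma bilinQDl u u' v : bilinQ (u + u') v = bilinQ u v + bilinQ u' v.
Proof. exact: tens_liftD. Qed.

Lemma bilinQDr u v v' : bilinQ u (v + v') = bilinQ u v + bilinQ u v'.
Proof.
rewrite -tens_lift_addb; apply: eq_tens_lift => x p.
exact: tens_liftD.
Qed.

Lemma bilinQZl a u v : bilinQ (a *: u) v = a *: bilinQ u v.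
Proof.
move: u; apply: tens_ext => [u w|u w|x p]; rewrite ?scalerDr ?bilinQDl ?scalerDr //.
move: v; apply: tens_ext => [v w|v w|y q]; rewrite ?bilinQDr ?scalerDr //.
by rewrite tensQ_scaleE !bilinQ_pure tensQ_scaleE mulrA.
Qed.

Lemma bilinQZr a u v : bilinQ u (a *: v) = a *: bilinQ u v.
Proof.
move: u; apply: tens_ext => [u w|u w|x p]; rewrite ?bilinQDl ?scalerDr //.
move: v; apply: tens_ext => [v w|v w|y q]; rewrite ?scalerDr ?bilinQDr ?scalerDr //.
by rewrite tensQ_scaleE !bilinQ_pure tensQ_scaleE mulrCA.
Qed.

Lemma bilinQ0l v : bilinQ 0 v = 0.
Proof. by apply: (addIr (bilinQ 0 v)); rewrite -bilinQDl !add0r. Qed.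
Lemma bilinQ0r u : bilinQ u 0 = 0.
Proof. by apply: (addIr (bilinQ u 0)); rewrite -bilinQDr !add0r. Qed.

End BilinQ.

Record dsum (V : degree -> lmodType rat) := DSum {
  dval :> forall k, V k;
  dval_fin : finite_set [set k | dval k != 0] }.

HB.instance Definition _ V := gen_eqMixin (dsum V).
HB.instance Definition _ V := gen_choiceMixin (dsum V).

Lemma fsumrD (T : choiceType) (W : zmodType) (f g : T -> W) :
  finite_set [set p | f p != 0] -> finite_set [set p | g p != 0] ->
  \sum_(p \in [set: T]) (f p + g p) =
  \sum_(p \in [set: T]) f p + \sum_(p \in [set: T]) g p.
Proof.
move=> ff fg; pose D := [set p | f p != 0] `|` [set p | g p != 0].
have fD p : (setT `\` D) p -> f p = 0 /\ g p = 0.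
  move=> [_ /not_orP[/negP + /negP]]; rewrite !negbK.
  by move=> /eqP -> /eqP ->.
rewrite -!(fsbig_widen D setT) //; last 3 first.
- by move=> p /fD[].
- by move=> p /fD[].
- by move=> p /fD[/= -> ->]; rewrite addr0.
by rewrite fsbig_split //= finite_setU.
Qed.

Section DSum.
Variable V : degree -> lmodType rat.
Implicit Types (u v w : dsum V) (a b : rat).

Lemma dsumP u v : (forall k, u k = v k) -> u = v.
Proof.
case: u => u uf; case: v => v vf /= uv.
have {}uv : u = v by apply: functional_extensionality_dep.
by subst v; congr DSum; apply: Prop_irrelevance.
Qed.

Lemma dsum_zero_fin : finite_set [set k | (0 : V k) != 0].
Proof.
by rewrite (_ : [set _ | _] = set0) // -subset0 => k /=; rewrite eqxx.
Qed.

Lemma dsum_add_fin u v : finite_set [set k | u k + v k != 0].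
Proof.
apply: (@sub_finite_set _ _ ([set k | u k != 0] `|` [set k | v k != 0])).
  move=> k /=; have [->|u0] := eqVneq (u k) 0; last by left.
  by rewrite add0r; right.
by rewrite finite_setU; split; apply: dval_fin.
Qed.

Lemma dsum_opp_fin u : finite_set [set k | - u k != 0].
Proof.
by apply: sub_finite_set (dval_fin u) => k /=; rewrite oppr_eq0.
Qed.

Lemma dsum_scale_fin a u : finite_set [set k | a *: u k != 0].
Proof.
apply: sub_finite_set (dval_fin u) => k /=.
by apply: contra_neq => ->; rewrite scaler0.
Qed.

Definition dsum_zero : dsum V := DSum dsum_zero_fin.
Definition dsum_add u v : dsum V := DSum (dsum_add_fin u v).
Definition dsum_opp u : dsum V := DSum (dsum_opp_fin u).
Definition dsum_scale a u : dsum V := DSum (dsum_scale_fin a u).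

Lemma dsum_addA : associative dsum_add.
Proof. by move=> u v w; apply: dsumP => k /=; rewrite addrA. Qed.
Lemma dsum_addC : commutative dsum_add.
Proof. by move=> u v; apply: dsumP => k /=; rewrite addrC. Qed.
Lemma dsum_add0 : left_id dsum_zero dsum_add.
Proof. by move=> u; apply: dsumP => k /=; rewrite add0r. Qed.
Lemma dsum_addN : left_inverse dsum_zero dsum_opp dsum_add.
Proof. by move=> u; apply: dsumP => k /=; rewrite addNr. Qed.
HB.instance Definition _ :=
  GRing.isZmodule.Build (dsum V) dsum_addA dsum_addC dsum_add0 dsum_addN.

Lemma dsum_scaleA a b u : dsum_scale a (dsum_scale b u) = dsum_scale (a * b) u.
Proof. by apply: dsumP => k /=; rewrite scalerA. Qed.
Lemma dsum_scale1 : left_id 1 dsum_scale.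
Proof. by move=> u; apply: dsumP => k /=; rewrite scale1r. Qed.
Lemma dsum_scaleDr : right_distributive dsum_scale +%R.
Proof. by move=> a u v; apply: dsumP => k /=; rewrite scalerDr. Qed.
Lemma dsum_scaleDl u : {morph dsum_scale^~ u : a b / a + b}.
Proof. by move=> a b; apply: dsumP => k /=; rewrite scalerDl. Qed.
HB.instance Definition _ := GRing.Zmodule_isLmodule.Build rat (dsum V)
  dsum_scaleA dsum_scale1 dsum_scaleDr dsum_scaleDl.

Lemma dsum0E k : (0 : dsum V) k = 0. Proof. by []. Qed.
Lemma dsumDE u v k : (u + v) k = u k + v k. Proof. by []. Qed.
Lemma dsumZE a u k : (a *: u) k = a *: u k. Proof. by []. Qed.

Definition dinj_val k (x : V k) (j : degree) : V j :=
  match k =P j with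
  | ReflectT e => eq_rect k V x j e
  | ReflectF _ => 0
  end.

Lemma dinj_valE k (x : V k) : dinj_val x k = x.
Proof.
rewrite /dinj_val; case: eqP => // e.
by rewrite (Prop_irrelevance e erefl).
Qed.

Lemma dinj_val_neq k (x : V k) j : k != j -> dinj_val x j = 0.
Proof. by rewrite /dinj_val; case: eqP => // -> /eqP. Qed.

Lemma dinj_fin k (x : V k) : finite_set [set j | dinj_val x j != 0].
Proof.
apply: sub_finite_set (finite_set1 k) => j /=; apply: contra_neqP => /eqP.
by rewrite eq_sym; apply: dinj_val_neq.
Qed.

Definition dinj k (x : V k) : dsum V := DSum (dinj_fin x).

Lemma dinjE k (x : V k) : dinj x k = x. Proof. exact: dinj_valE. Qed.

Fact dinj_is_linear k : linear (@dinj k).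
Proof.
move=> a x y; apply: dsumP => j; rewrite dsumDE dsumZE /=.
have [<-|kj] := eqVneq k j; first by rewrite !dinj_valE.
by rewrite !dinj_val_neq // scaler0 addr0.
Qed.
HB.instance Definition _ k :=
  GRing.isLinear.Build rat (V k) (dsum V) _ (@dinj k) (@dinj_is_linear k).

End DSum.

Section GradedLie.
Variables (G : groupType) (A : nseries G).

Definition grQ (k : degree) : lmodType rat := tensQ (gr A k).

Lemma gr_br_biadditive i j : biadditive (@gr_br G A i j).
Proof. by split=> [v u u'|u v v']; [apply: gr_brDl|apply: gr_brDr]. Qed.

Definition grQ_br i j (x : grQ i) (y : grQ j) : grQ (addd i j) :=
  bilinQ (@gr_br G A i j) x y.

Definition grLie : lmodType rat := dsum grQ.

(* Only finitely many pairs of degrees contribute (lie_br_fin), so that this is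
   the bilinear extension of the brackets of homogeneous elements. *)
Definition lie_br (u v : grLie) : grLie :=
  \sum_(p \in [set: degree * degree]) dinj (grQ_br (u p.1) (v p.2)).

Lemma lie_br_fin (u v : grLie) : finite_set
  [set p : degree * degree | dinj (grQ_br (u p.1) (v p.2)) != 0].
Proof.
apply: sub_finite_set (finite_setX (dval_fin u) (dval_fin v)) => -[i j] /=.
apply: contra_neqP => /not_andP [] /negP; rewrite negbK => /eqP ->.
  by rewrite /grQ_br bilinQ0l ?linear0 //; apply: gr_br_biadditive.
by rewrite /grQ_br bilinQ0r ?linear0 //; apply: gr_br_biadditive.
Qed.

Lemma lie_br_dinj i j (x : grQ i) (y : grQ j) :
  lie_br (dinj x) (dinj y) = dinj (grQ_br x y).
Proof.
rewrite /lie_br -(fsbig_widen [set (i, j)]) ?fsbig_set1 /= ?dinj_valE //.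
move=> -[k l] /= [_ /eqP]; rewrite xpair_eqE negb_and => /orP[ki|lj].
  by rewrite dinj_val_neq 1?eq_sym // /grQ_br bilinQ0l ?linear0 //;
     apply: gr_br_biadditive.
by rewrite [X in grQ_br _ X]dinj_val_neq 1?eq_sym // /grQ_br bilinQ0r ?linear0 //;
   apply: gr_br_biadditive.
Qed.

Lemma lie_brDl (u u' v : grLie) : lie_br (u + u') v = lie_br u v + lie_br u' v.
Proof.
rewrite /lie_br -fsumrD; [|exact: lie_br_fin..].
apply: eq_fsbigr => p _; rewrite dsumDE -linearD /grQ_br bilinQDl //.
exact: gr_br_biadditive.
Qed.

Lemma lie_brDr (u v v' : grLie) : lie_br u (v + v') = lie_br u v + lie_br u v'.
Proof.
rewrite /lie_br -fsumrD; [|exact: lie_br_fin..].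
apply: eq_fsbigr => p _; rewrite dsumDE -linearD /grQ_br bilinQDr //.
exact: gr_br_biadditive.
Qed.

Definition lie_subalgebra (S : set grLie) : Prop :=
  [/\ S 0, forall u v, S u -> S v -> S (u + v),
      forall (a : rat) u, S u -> S (a *: u) &
      forall u v, S u -> S v -> S (lie_br u v)].

Definition lie_generated (S : set grLie) : set grLie :=
  smallest lie_subalgebra S.

Definition homogeneous (k : degree) : set grLie := range (@dinj grQ k).

End GradedLie.

(* Gamma_k IA / Gamma_(k+1) IA -> A[k] / A[k+1] *)
Definition Upsilon (F : groupType) (k : degree) :
    {additive gr (IA_nseries F) k -> gr (andre_nseries F) k} :=
  @gr_incl _ (IA_nseries F) (andre_nseries F) (@lcs_IA_andre F) k.

Definition UpsilonQ (F : groupType) (k : degree) :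
    {linear grQ (IA_nseries F) k -> grQ (andre_nseries F) k} :=
  mapQ (Upsilon F k).

(* Main.v *)
From HB Require Import structures.
Require Import Defs.
From mathcomp Require Import all_boot all_order all_algebra.
From mathcomp Require Import perm zify ring.
From mathcomp Require Import boolp classical_sets functions.

(** The surjectivity holds already over the integers: for n >= k + 2 every f in
    A[k] agrees modulo A[k+1] with an element of Gamma_k IA. The Johnson
    homomorphism sends f to the tuple of the classes of f(x_i) x_i^-1 in
    Gamma_(k+1) F / Gamma_(k+2) F, that is, to a derivation of degree k of the
    graded Lie ring of F; its kernel in A[k] is A[k+1] (johnson_ker), and group
    commutators induce the brackets of derivations (cls_disp_comm). It remains to
    compare the image of Gamma_k IA with the image of A[k] in the group of all
    derivations.

    The image of Gamma_k IA is large. Explicit automorphisms realize every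
    derivation x_i |-> [x_a, x_b] of degree 1. Their iterated brackets contain
    every x_i |-> u with u not involving x_i (img_free). Modulo the image, any
    other derivation can be moved to a fresh generator x_c and becomes a
    combination of x_c |-> [x_c, w], where w is a word of length k avoiding c
    (img_move, word_der_span); up to the image this does not depend on c, nor on w
    up to rotation (img_swap, word_der_rot). This is where n >= k + 2 is used: one
    needs generators outside of the letters that already occur. So the cokernel is
    generated by the cyclic words of length k (Satoh).

    The image of A[k] is not larger, because each cyclic word is detected by a
    functional vanishing on A[k]. For k > 1 and a word w of length k, let x_i act
    on Z[t]^k by the product of the elementary matrices 1 + t E_(j+1, j) over the
    positions j, modulo k, at which the letter of w is i. The Fox Jacobian of an
    automorphism f, evaluated in this representation, is invertible over Z[t]
    (jacobian_unit); for f in A[k] it has the form 1 + t^k M, and since the units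
    of Z[t] are constants, the trace of M vanishes at t = 0 (trace_of_unit). This
    trace only depends on the image of f under the Johnson homomorphism. On the
    derivation x_c |-> [x_c, u] it equals, up to sign, the number of rotations of
    w equal to u (word_trace_exists), so it is nonzero for u = w and vanishes when
    u is not a rotation of w. A combination of cyclic words killed by all these
    functionals is zero (img_of_traces), which gives the integral statement
    (andre_lcs_mod).

    Finally, Gamma_k IA is generated by iterated commutators of elements of IA,
    whose classes are iterated Lie brackets of elements of degree 1; hence the
    surjectivity implies that the degree k part of the Lie algebra is generated by
    the degree 1 part (UpsilonQ_generated). *)

Set Implicit Arguments.
Unset Strict Implicit.
Unset Printing Implicit Defensive.

Import GRing.Theory.
Local Open Scope group_scope.
Local Open Scope classical_set_scope.

(** * Additive subgroups *)

Section AdditiveSpan.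
Variable V : zmodType.
Local Open Scope ring_scope.
Implicit Types S T : set V.

Definition zsub T : Prop := T 0 /\ forall u v, T u -> T v -> T (u - v).

Definition zspan S : set V := smallest zsub S.

Lemma zsubN T u : zsub T -> T u -> T (- u).
Proof. by case=> T0 TB Tu; rewrite -sub0r; apply: TB. Qed.

Lemma zsubD T u v : zsub T -> T u -> T v -> T (u + v).
Proof. by move=> sT Tu Tv; rewrite -[v]opprK; apply: sT.2 => //; apply: zsubN. Qed.

Lemma zsub_sum T (I : finType) (P : pred I) (E : I -> V) : zsub T ->
  (forall i, P i -> T (E i)) -> T (\sum_(i | P i) E i).
Proof. by move=> sT TE; apply: big_ind => //; [apply: sT.1 | move=> *; apply: zsubD]. Qed.

Lemma zsub_zspan S : zsub (zspan S).
Proof.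
split=> [T [[T0 _] _] //|u v Su Sv T sT].
by case: (sT) => -[_ TB] _; apply: TB; [apply: Su | apply: Sv].
Qed.

Lemma zspan_gen S u : S u -> zspan S u.
Proof. exact: sub_gen_smallest. Qed.

Lemma zspan_min S T u : zsub T -> S `<=` T -> zspan S u -> T u.
Proof. by move=> sT ST; apply: smallest_sub. Qed.

End AdditiveSpan.

Lemma zsub_preim (V W : zmodType) (f : V -> W) (T : set W) :
  {morph f : u v / (u + v)%R} -> zsub T -> zsub [set u | T (f u)].
Proof.
move=> fD sT; have f0 : f 0%R = 0%R by apply: (addIr (f 0%R)); rewrite -fD !add0r.
split=> [|u v Tu Tv] /=; first by rewrite f0; apply: sT.1.
have -> : f (u - v)%R = (f u - f v)%R by apply: (addIr (f v)); rewrite -fD !subrK.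
exact: sT.2.
Qed.

(** * Classes in the graded pieces of a strongly central filtration *)

Definition dS (k : nat) : degree := @Degree k.+1 isT.

Section Classes.
Variables (G : groupType) (A : nseries G).
Implicit Types (a b c m : degree) (x y z : G).

(** Made total by the value 0 outside the filtration step: as a plain function
    of the group element it can be rewritten along equalities between degrees
    without any transport. *)
Definition cls m x : gr A m :=
  if pselect (A m x) is left Ax then gr_class Ax else 0%R.

Lemma clsE m x (Ax : A m x) : cls m x = gr_class Ax.
Proof. by rewrite /cls; case: pselect => // Ax'; apply: gr_class_eq. Qed.

Lemma clsM m x y : A m x -> A m y -> cls m (x * y) = (cls m x + cls m y)%R.
Proof.
by move=> Ax Ay; rewrite (clsE Ax) (clsE Ay) (clsE (ntermM Ax Ay)) gr_classD.
Qed.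

Lemma cls1 m : cls m 1 = 0%R.
Proof. by rewrite (clsE (nterm1 A m)). Qed.

Lemma clsV m x : A m x -> cls m x^-1 = (- cls m x)%R.
Proof.
move=> Ax; apply: (addIr (cls m x)); rewrite -clsM //; last exact: ntermV.
by rewrite mulVg cls1 addNr.
Qed.

Lemma cls_eq0 m x : A m x -> (cls m x = 0%R <-> A m.+1 x).
Proof.
move=> Ax; rewrite -(cls1 m) (clsE Ax) (clsE (nterm1 A m)) gr_classP mulg1.
by split=> /ntermSV; rewrite ?invgK.
Qed.

Lemma cls0 m x : A m.+1 x -> cls m x = 0%R.
Proof. by move=> Ax; apply/cls_eq0 => //; apply: ntermS. Qed.

Lemma cls_repr m (u : gr A m) : cls m (gr_repr u) = u.
Proof. by rewrite (clsE (gr_reprP u)) gr_reprK. Qed.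

Lemma cls_ind m (P : gr A m -> Prop) :
  (forall x, A m x -> P (cls m x)) -> forall u, P u.
Proof. by move=> Px u; rewrite -(cls_repr u); apply: Px; apply: gr_reprP. Qed.

Lemma cls_congr m x y : A m x -> A m.+1 y -> cls m (x * y) = cls m x.
Proof. by move=> Ax Ay; rewrite clsM ?(cls0 Ay) ?addr0 //; apply: ntermS. Qed.

Lemma nterm_le (p q : nat) x : (0 < p)%N -> (p <= q)%N -> A q x -> A p x.
Proof.
move=> p0 /subnKC <-; elim: (q - p)%N => [|d IH]; first by rewrite addn0.
by rewrite addnS => /nterm_decr; rewrite addn_gt0 p0 => /(_ isT).
Qed.

Lemma nterm_comm_eq a b m x y : m = (a + b)%N :> nat ->
  A a x -> A b y -> A m [~ x, y].
Proof. by move=> ->; apply: nterm_comm; apply: deg_gt0. Qed.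

Lemma nterm_comm_lt a b m x y : (m < a + b)%N ->
  A a x -> A b y -> A m.+1 [~ x, y].
Proof. by move=> mab; apply: nterm_commS; rewrite ?deg_gt0. Qed.

Lemma clsJ a b x y : A a x -> A b y -> cls a (x ^ y) = cls a x.
Proof.
move=> Ax Ay; have -> : x ^ y = x * [~ x, y] by rewrite commgEl mulVKg.
apply: cls_congr => //; apply: nterm_comm_lt Ax Ay.
by rewrite -[X in (X < _)%N]addn0 ltn_add2l deg_gt0.
Qed.

(** The Lie bracket of the graded pieces, with a free target degree: the
    condition that it is the sum of the two source degrees is a hypothesis of
    the lemmas and not part of the type. *)
Definition brk a b m (u : gr A a) (v : gr A b) : gr A m :=
  cls m [~ gr_repr u, gr_repr v].

Section Bracket.
Variables (a b m : degree).
Hypothesis mab : m = (a + b)%N :> nat.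

Let mE : m = addd a b. Proof. exact: val_inj. Qed.

Let brk_gr_br (u : gr A a) (v : gr A b) : brk (addd a b) u v = gr_br u v.
Proof. by rewrite /brk /gr_br (clsE (gr_br_subproof u v)). Qed.

Lemma brkE x y : A a x -> A b y -> brk m (cls a x) (cls b y) = cls m [~ x, y].
Proof.
move=> Ax Ay; rewrite mE brk_gr_br (clsE Ax) (clsE Ay) gr_brE.
by rewrite (clsE (nterm_addd Ax Ay)).
Qed.

Lemma brkDl (v : gr A b) : {morph (fun u : gr A a => brk m u v) : u u' / (u + u')%R}.
Proof. by move=> u u'; rewrite mE !brk_gr_br gr_brDl. Qed.

Lemma brkDr (u : gr A a) : {morph (fun v : gr A b => brk m u v) : v v' / (v + v')%R}.
Proof. by move=> v v'; rewrite mE !brk_gr_br gr_brDr. Qed.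

Lemma brk0r (u : gr A a) : brk m u (0%R : gr A b) = 0%R.
Proof. by apply: (addIr (brk m u (0%R : gr A b))); rewrite -brkDr !add0r. Qed.

Lemma cls_commMl x x' y : A a x -> A a x' -> A b y ->
  cls m [~ x * x', y] = (cls m [~ x, y] + cls m [~ x', y])%R.
Proof.
by move=> Ax Ax' Ay; rewrite -!brkE ?clsM ?brkDl //; apply: ntermM.
Qed.

Lemma cls_commMr x y y' : A a x -> A b y -> A b y' ->
  cls m [~ x, y * y'] = (cls m [~ x, y] + cls m [~ x, y'])%R.
Proof.
by move=> Ax Ay Ay'; rewrite -!brkE ?clsM ?brkDr //; apply: ntermM.
Qed.

Lemma cls_commVl x y : A a x -> A b y -> cls m [~ x^-1, y] = (- cls m [~ x, y])%R.
Proof.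
move=> Ax Ay; apply: (addIr (cls m [~ x, y])); rewrite -cls_commMl //; last exact: ntermV.
by rewrite mulVg comm1g cls1 addNr.
Qed.

Lemma cls_commVr x y : A a x -> A b y -> cls m [~ x, y^-1] = (- cls m [~ x, y])%R.
Proof.
move=> Ax Ay; apply: (addIr (cls m [~ x, y])); rewrite -cls_commMr //; last exact: ntermV.
by rewrite mulVg commg1 cls1 addNr.
Qed.

Lemma cls_commC x y : A a x -> A b y -> cls m [~ y, x] = (- cls m [~ x, y])%R.
Proof.
move=> Ax Ay; rewrite -invgR clsV //; exact: nterm_comm_eq Ax Ay.
Qed.

End Bracket.

Lemma nterm_eqdeg a b x : a = b :> nat -> A a x -> A b x.
Proof. by move=> ->. Qed.

Lemma cls_comm3V a b c m x y z : m = (a + b + c)%N :> nat ->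
  A a x -> A b y -> A c z ->
  cls m [~ x, y^-1, z] = (- cls m [~ [~ x, y], z])%R.
Proof.
move=> mE Ax Ay Az; have m1 : m = (addd a b + c)%N :> nat by [].
have Axy := nterm_addd Ax Ay; have Axy' := nterm_addd Ax (ntermV Ay).
rewrite -(cls_commVl m1) // -!(brkE m1) //; last exact: ntermV.
by rewrite clsV // (cls_commVr (a := a) (b := b)).
Qed.

(** The Hall-Witt identity, whose outer conjugations act trivially on classes. *)
Lemma cls_Jacobi a b c m x y z : m = (a + b + c)%N :> nat ->
  A a x -> A b y -> A c z ->
  cls m [~ x, [~ y, z]] = (cls m [~ [~ x, y], z] - cls m [~ [~ x, z], y])%R.
Proof.
move=> mE Ax Ay Az.
have m2 : m = (b + c + a)%N :> nat by rewrite mE -addnA addnC.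
have m3 : m = (c + a + b)%N :> nat by rewrite mE addnC addnA.
have m4 : m = (addd c a + b)%N :> nat by [].
have Azx := nterm_addd Az Ax; have Ayz := nterm_addd Ay Az.
have tri (p q r : degree) t t' t'' : m = (p + q + r)%N :> nat ->
    A p t -> A q t' -> A r t'' -> A m [~ [~ t, t'], t''].
  by move=> mpqr At At' At''; apply: (@nterm_comm_eq (addd p q) r) => //; apply: nterm_addd.
have AJ (d : degree) t t' : A m t -> A d t' -> A m (t ^ t').
  move=> At At'; have -> : t ^ t' = t * [~ t, t'] by rewrite commgEl mulVKg.
  apply: ntermM => //; apply: ntermS; apply: nterm_comm_lt At At'.
  by rewrite -[X in (X < _)%N]addn0 ltn_add2l deg_gt0.
have T1 := tri _ _ _ _ _ _ mE Ax (ntermV Ay) Az.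
have T2 := tri _ _ _ _ _ _ m2 Ay (ntermV Az) Ax.
have T3 := tri _ _ _ _ _ _ m3 Az (ntermV Ax) Ay.
have := congr1 (cls m) (Hall_Witt x y z); rewrite cls1 clsM; last first.
- exact: AJ T3 Ax.
- by apply: ntermM; [apply: AJ T1 Ay | apply: AJ T2 Az].
rewrite clsM; [|exact: AJ T1 Ay|exact: AJ T2 Az].
rewrite (clsJ T1 Ay) (clsJ T2 Az) (clsJ T3 Ax).
rewrite (cls_comm3V mE) // (cls_comm3V m2) // (cls_comm3V m3) //.
rewrite (@cls_commC (addd b c) a m m2 [~ y, z] x Ayz Ax) => /eqP.
have -> : cls m [~ [~ x, z], y] = (- cls m [~ [~ z, x], y])%R.
  by rewrite -(cls_commVl m4) // invgR.
rewrite opprK; set p := cls m [~ [~ x, y], z]; set q := cls m _; set r := cls m _.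
by rewrite -!opprD oppr_eq0 addrAC addr_eq0 => /eqP ->.
Qed.

End Classes.

(** * Homomorphisms out of a free group *)

Record subgroup_type (G : groupType) (H : set G) (sH : subgroup H) :=
  SubgroupElt { sub_elt :> G; sub_eltP : H sub_elt }.

HB.instance Definition _ G H sH := gen_eqMixin (@subgroup_type G H sH).
HB.instance Definition _ G H sH := gen_choiceMixin (@subgroup_type G H sH).

Section SubgroupType.
Variables (G : groupType) (H : set G) (sH : subgroup H).
Implicit Types u v w : subgroup_type sH.

Lemma sub_elt_inj u v : u = v :> G -> u = v.
Proof.
case: u => u Hu; case: v => v Hv /= uv; subst v.
by congr SubgroupElt; apply: Prop_irrelevance.
Qed.

Definition sub_one := SubgroupElt sH (let: And3 H1 _ _ := sH in H1).
Definition sub_mul u v : subgroup_type sH :=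
  SubgroupElt sH (let: And3 _ HM _ := sH in HM _ _ (sub_eltP u) (sub_eltP v)).
Definition sub_inv u : subgroup_type sH :=
  SubgroupElt sH (let: And3 _ _ HV := sH in HV _ (sub_eltP u)).

Lemma sub_mulA : associative sub_mul.
Proof. by move=> u v w; apply: sub_elt_inj; rewrite /= mulgA. Qed.
Lemma sub_mul1 : left_id sub_one sub_mul.
Proof. by move=> u; apply: sub_elt_inj; rewrite /= mul1g. Qed.
Lemma sub_mulr1 : right_id sub_one sub_mul.
Proof. by move=> u; apply: sub_elt_inj; rewrite /= mulg1. Qed.
Lemma sub_mulV : left_inverse sub_one sub_inv sub_mul.
Proof. by move=> u; apply: sub_elt_inj; rewrite /= mulVg. Qed.
Lemma sub_mulrV : right_inverse sub_one sub_inv sub_mul.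
Proof. by move=> u; apply: sub_elt_inj; rewrite /= mulgV. Qed.
HB.instance Definition _ := isGroup.Build (subgroup_type sH)
  sub_mulA sub_mul1 sub_mulr1 sub_mulV sub_mulrV.

End SubgroupType.

Section FreeGroup.
Variables (F : groupType) (n : nat) (x : 'I_n -> F).
Hypothesis freeF : free_basis x.

Lemma free_hom (H : groupType) (h : 'I_n -> H) :
  {f : F -> H | {morph f : a b / a * b} & forall i, f (x i) = h i}.
Proof.
by apply: cid2; have [f [[fM fx] _]] := freeF h; exists f.
Qed.

(** The retraction of [F] onto a subgroup containing the basis, followed by the
    inclusion, is the identity by the uniqueness of extensions. *)
Lemma free_generated (H : set F) : subgroup H -> (forall i, H (x i)) ->
  forall y, H y.
Proof.
move=> sH Hx y.
have [f fM fx] := free_hom (fun i => SubgroupElt sH (Hx i)).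
have [g [_ gU]] := freeF x.
have g1 := gU id (conj (fun _ _ => erefl) (fun=> erefl)).
have gf : g = fun z => f z :> F.
  by apply: gU; split=> [a b|i]; rewrite ?fM ?fx.
have -> : y = f y by rewrite -[LHS]/(id y) -g1 gf.
exact: sub_eltP.
Qed.

Lemma free_hom_ext (H : groupType) (f g : F -> H) :
  {morph f : a b / a * b} -> {morph g : a b / a * b} ->
  (forall i, f (x i) = g (x i)) -> f =1 g.
Proof.
move=> fM gM fg; have [h [_ hU]] := freeF (fun i => g (x i)).
by move=> y; rewrite -(hU f) ?(hU g).
Qed.

(** An endomorphism moving a single generator x_i to a x_i b, where a and b are
    words in the other generators: its inverse moves x_i to a^-1 x_i b^-1. *)
Lemma transvection (i : 'I_n) (a b : F) :
  generated [set x j | j in [set j | j != i]] a ->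
  generated [set x j | j in [set j | j != i]] b ->
  exists f : aut F, f (x i) = a * x i * b /\ forall j, j != i -> f (x j) = x j.
Proof.
move=> Ga Gb.
pose h c d j := if j == i then c * x i * d else x j.
have fixed (f : F -> F) c : {morph f : u v / u * v} ->
    (forall j, j != i -> f (x j) = x j) ->
    generated [set x j | j in [set j | j != i]] c -> f c = c.
  move=> fM fx; apply: (@smallest_sub _ _ _ [set c | f c = c]); last first.
    by move=> _ [j /= ji <-]; apply: fx.
  have f1 : f 1 = 1 by apply: (mulgI (f 1)); rewrite -fM !mulg1.
  split=> [//|u v /= fu fv|u /= fu]; first by rewrite fM fu fv.
  by apply: (mulgI u); rewrite -{1}fu -fM !mulgV f1.
have [f fM fx] := free_hom (h a b).
have [g gM gx] := free_hom (h a^-1 b^-1).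
have fj j : j != i -> f (x j) = x j by rewrite fx /h => /negbTE ->.
have gj j : j != i -> g (x j) = x j by rewrite gx /h => /negbTE ->.
have [_ _ GV] := subgroup_generated [set x j | j in [set j | j != i]].
have fi : f (x i) = a * x i * b by rewrite fx /h eqxx.
have gi : g (x i) = a^-1 * x i * b^-1 by rewrite gx /h eqxx.
have gf : cancel f g.
  move=> y; apply: (@free_hom_ext F (g \o f) id) => [u v|//|j]; first by rewrite /= fM gM.
  have [->|ji] := eqVneq j i; last by rewrite /= fj // gj.
  by rewrite /= fi !gM gi !(fixed g) // !mulgA mulgV mul1g mulgVK.
have fg : cancel g f.
  move=> y; apply: (@free_hom_ext F (f \o g) id) => [u v|//|j]; first by rewrite /= gM fM.
  have [->|ji] := eqVneq j i; last by rewrite /= gj // fj.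
  rewrite /= gi !fM fi !(fixed f) //; [|exact: GV..].
  by rewrite !mulgA mulVg mul1g mulgK.
by exists (Aut gf fg fM); split.
Qed.

End FreeGroup.

(** * The action of the Andreadakis filtration on the lower central series *)

Section Action.
Variable F : groupType.
Local Notation LN := (lcs_nseries (subgroup_setT F)).
Implicit Types (a b m M k l : degree) (f g : aut F) (y z : F).

Definition disp f y : F := f y * y^-1.

Lemma lcs_conj m y z : LN m y -> LN m (y ^ z).
Proof. by move=> Ly; apply: (lcs_normalised (subgroup_setT F) Ly). Qed.

Lemma disp_in m M k f y : M = (m + k)%N :> nat ->
  andre k f -> LN m y -> LN M (disp f y).
Proof. by move=> -> Af Ly; apply: andre_lcs; rewrite ?deg_gt0. Qed.

Lemma disp_deep (m : degree) M (k : nat) f y : (M < m + k)%N ->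
  andre k f -> LN m y -> LN M.+1 (disp f y).
Proof.
move=> Mmk Af Ly; apply: (@nterm_le _ LN _ (m + k)) => //.
by apply: andre_lcs; rewrite ?deg_gt0.
Qed.

Lemma cls_dispM m M k f y z : M = (m + k)%N :> nat ->
  andre k f -> LN m y -> LN m z ->
  cls LN M (disp f (y * z)) = (cls LN M (disp f y) + cls LN M (disp f z))%R.
Proof.
move=> ME Af Ly Lz.
have -> : disp f (y * z) = disp f y * disp f z ^ y^-1.
  by rewrite /disp autfM /conjg invgM invgK !mulgA mulgVK.
have Dz := disp_in ME Af Lz.
rewrite clsM; [|exact: disp_in ME Af Ly|exact: lcs_conj].
by rewrite (clsJ Dz (ntermV Ly)).
Qed.

Lemma disp1 f : disp f 1 = 1. Proof. by rewrite /disp autf1 mulgV. Qed.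

(** An automorphism of the k-th filtration step acts on the graded Lie ring of
    F by a derivation of degree k. *)
Lemma cls_dispR a b M k f y z : M = (a + b + k)%N :> nat ->
  andre k f -> LN a y -> LN b z ->
  cls LN M (disp f [~ y, z]) =
    (cls LN M [~ disp f y, z] + cls LN M [~ y, disp f z])%R.
Proof.
move=> ME Af Ly Lz.
have M1 : M = (addd a k + b)%N :> nat by rewrite ME /= addnAC.
have M2 : M = (a + addd b k)%N :> nat by rewrite ME /= addnA.
have Du : LN (addd a k) (disp f y) by apply: (disp_in _ Af Ly).
have Dv : LN (addd b k) (disp f z) by apply: (disp_in _ Af Lz).
have Dv' : LN b (disp f z).
  by apply: (@nterm_le _ LN b (addd b k)); rewrite ?deg_gt0 //= leq_addr.
have -> : disp f [~ y, z] =
    [~ disp f y, disp f z * z] ^ y * ([~ y, disp f z] ^ z) ^ [~ y, z]^-1.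
  rewrite /disp autfR mulgVK.
  have -> : f y = f y * y^-1 * y by rewrite mulgVK.
  have -> : f z = f z * z^-1 * z by rewrite mulgVK.
  rewrite -/(disp f y) -/(disp f z); move: (disp f y) (disp f z) => u v.
  rewrite mulgK /commg /conjg !invgM !invgK !mulgA.
  by rewrite ?mulgK ?mulgVK ?mulgK ?mulgVK.
have C1 : LN M [~ disp f y, disp f z * z].
  by apply: (nterm_comm_eq M1) => //; apply: ntermM.
have C2 : LN M [~ y, disp f z] by apply: (nterm_comm_eq M2).
have J t w : LN M t -> LN M (t ^ w) by apply: lcs_conj.
have cJ t w : LN M t -> cls LN M (t ^ w) = cls LN M t.
  by move=> Lt; apply: (@clsJ _ LN M deg1).
rewrite clsM; [|exact: J|by do 2!apply: (J)].
rewrite !cJ //; last exact: J.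
rewrite (cls_commMr M1) // [X in (X + _ + _)%R]cls0 ?add0r //.
apply: nterm_comm_lt Du Dv; rewrite ME /= addnACA ltn_add2l.
by rewrite -[X in (X < _)%N]addn0 ltn_add2l deg_gt0.
Qed.

Lemma cls_disp_mul m M k f g y : M = (m + k)%N :> nat ->
  andre k f -> andre k g -> LN m y ->
  cls LN M (disp (f * g) y) = (cls LN M (disp f y) + cls LN M (disp g y))%R.
Proof.
move=> ME Af Ag Ly.
have Dg : LN (addd m k) (disp g y) by apply: (disp_in _ Ag Ly).
have Dg' : LN m (disp g y).
  by apply: (@nterm_le _ LN m (addd m k)); rewrite ?deg_gt0 //= leq_addr.
have -> : disp (f * g) y = disp f (disp g y * y) * disp g y.
  by rewrite /disp autME mulgVK !mulgA mulgVK.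
rewrite clsM; [|by apply: (disp_in ME Af); apply: ntermM|exact: disp_in ME Ag Ly].
rewrite (cls_dispM ME) // [X in (X + _ + _)%R]cls0 ?add0r //.
apply: (disp_deep _ Af Dg); rewrite ME /=.
by rewrite -[X in (X < _)%N]addn0 ltn_add2l deg_gt0.
Qed.

(** The bracket of two derivations is induced by the commutator of the
    automorphisms. *)
Lemma cls_disp_comm m M k l f g y : M = (m + k + l)%N :> nat ->
  andre k f -> andre l g -> LN m y ->
  cls LN M (disp [~ f, g] y) =
    (cls LN M (disp f (disp g y)) - cls LN M (disp g (disp f y)))%R.
Proof.
move=> ME Af Ag Ly.
have Du : LN (addd m k) (disp f y) by apply: (disp_in _ Af Ly).
have Dv : LN (addd m l) (disp g y) by apply: (disp_in _ Ag Ly).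
have Du' : LN M (disp g (disp f y)) by apply: (disp_in _ Ag Du).
have Dv' : LN M (disp f (disp g y)).
  by apply: (disp_in _ Af Dv); rewrite ME /= addnAC.
have -> : disp [~ f, g] y =
    ((g * f)^-1 : aut F) (disp f (disp g y) * [~ (disp g y)^-1, (disp f y)^-1]
                            * (disp g (disp f y))^-1).
  have -> : disp [~ f, g] y =
      ((g * f)^-1 : aut F) ((f * g) y * ((g * f) y)^-1).
    rewrite /disp; have -> : [~ f, g] = (g * f)^-1 * (f * g).
      by rewrite /commg /conjg invgM !mulgA.
    by rewrite autfM autfV -(autME _ (g * f)) mulVg aut1E autME.
  congr (_ _); rewrite !autME.
  have dE (h : aut F) w : h w = disp h w * w by rewrite mulgVK.
  have -> : f (g y) = disp f (disp g y) * disp g y * (disp f y * y).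
    by rewrite -(dE f (disp g y)) -(dE f y) -autfM -dE.
  have -> : g (f y) = disp g (disp f y) * disp f y * (disp g y * y).
    by rewrite -(dE g (disp f y)) -(dE g y) -autfM -dE.
  move: (disp f (disp g y)) (disp g (disp f y)) (disp f y) (disp g y) => p q r s.
  rewrite /commg /conjg !invgM !invgK !mulgA.
  by rewrite ?mulgK ?mulgVK ?mulgK ?mulgVK.
have Dc : LN M.+1 [~ (disp g y)^-1, (disp f y)^-1].
  apply: (nterm_comm_lt _ (ntermV Dv) (ntermV Du)); rewrite ME /= addnACA.
  by rewrite -addnA [(k + l)%N]addnC ltn_add2r -[X in (X < _)%N]addn0 ltn_add2l deg_gt0.
set t := _ * _ * _; have Lt : LN M t.
  by apply: ntermM; [apply: ntermM => //; apply: ntermS|apply: ntermV].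
have -> : ((g * f)^-1 : aut F) t = disp (g * f)^-1 t * t by rewrite mulgVK.
have A1 : andre 1 (g * f)^-1.
  have [_ AM AV] := subgroup_andre F 1.
  by apply: AV; apply: AM; [move: Ag | move: Af]; apply: (@nterm_le _ (andre_nseries F));
    rewrite ?deg_gt0.
have D1 : LN M.+1 (disp (g * f)^-1 t) by apply: (disp_deep _ A1 Lt); rewrite addn1.
rewrite clsM ?(cls0 D1) ?add0r //; last exact: ntermS.
rewrite /t clsM; [|by apply: ntermM => //; apply: ntermS|exact: ntermV].
by rewrite cls_congr // clsV.
Qed.

End Action.

(** * The Johnson homomorphisms *)

Section Johnson.
Variables (F : groupType) (n : nat) (x : 'I_n -> F).
Hypothesis freeF : free_basis x.
Local Notation LN := (lcs_nseries (subgroup_setT F)).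
Implicit Types (a b m M k l : degree) (f g : aut F) (y z : F) (i j c : 'I_n).
Implicit Types (s t w : seq 'I_n).

Lemma cls_gen1 (i : 'I_n) : LN deg1 (x i). Proof. by []. Qed.
Local Notation X1 := cls_gen1.

Lemma cls_disp_eq a M k f y z : M = (a + k)%N :> nat -> andre k f ->
  LN a y -> LN a z -> cls LN a y = cls LN a z ->
  cls LN M (disp f y) = cls LN M (disp f z).
Proof.
move=> ME Af Ly Lz yz; have Lyz : LN a (y * z^-1) by apply: ntermM; last exact: ntermV.
have Lyz1 : LN a.+1 (y * z^-1).
  by apply/(cls_eq0 Lyz); rewrite clsM ?clsV ?yz ?subrr //; apply: ntermV.
rewrite -[y](mulgVK z) (cls_dispM ME Af Lyz Lz) [X in (X + _)%R]cls0 ?add0r //.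
by apply: (@disp_deep F (dS a) M k) => //; rewrite ME.
Qed.

Definition johnson k f : {ffun 'I_n -> gr LN (dS k)} :=
  [ffun i => cls LN (dS k) (disp f (x i))].

Lemma johnsonM k f g : andre k f -> andre k g ->
  johnson k (f * g) = (johnson k f + johnson k g)%R.
Proof.
by move=> Af Ag; apply/ffunP => i; rewrite !ffunE (@cls_disp_mul F deg1 (dS k) k).
Qed.

Lemma johnson1 k : johnson k 1 = 0%R.
Proof. by apply/ffunP => i; rewrite !ffunE /disp aut1E mulgV cls1. Qed.

Lemma johnsonV k f : andre k f -> johnson k f^-1 = (- johnson k f)%R.
Proof.
move=> Af; apply: (addIr (johnson k f)); rewrite -johnsonM //.
  by rewrite mulVg johnson1 addNr.
by have [_ _ AV] := subgroup_andre F k; apply: AV.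
Qed.

Lemma andre_basis (k : nat) f : (forall i, LN (dS k) (disp f (x i))) -> andre k f.
Proof.
move=> fx; apply: (free_generated freeF) => //.
have [L1 LM LV] := subgroup_lcs (subgroup_setT F) k.+1; split=> [|y z fy fz|y fy].
- by rewrite autf1 mulgV.
- have -> : f (y * z) * (y * z)^-1 = (f y * y^-1) * (f z * z^-1) ^ y^-1.
    by rewrite autfM /conjg invgM invgK !mulgA mulgVK.
  by apply: LM => //; apply: Gam_J.
have -> : f y^-1 * y^-1^-1 = ((f y * y^-1)^-1) ^ y.
  by rewrite autfV /conjg !invgM !invgK !mulgA mulVg mul1g.
by apply: Gam_J; apply: LV.
Qed.

(** An automorphism is determined modulo a filtration step by its values on the
    basis, because the elements that it moves little form a subgroup. *)
Lemma johnson_ker k f : andre k f -> johnson k f = 0%R -> andre k.+1 f.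
Proof.
move=> Af /ffunP jf; apply: andre_basis => i.
have Lf : LN (dS k) (disp f (x i)) by apply: Af.
by have := jf i; rewrite !ffunE => /(cls_eq0 Lf).
Qed.

Definition single k i (u : gr LN (dS k)) : {ffun 'I_n -> gr LN (dS k)} :=
  [ffun j => if j == i then u else 0%R].

Lemma singleD k i : {morph @single k i : u v / (u + v)%R}.
Proof. by move=> u v; apply/ffunP => j; rewrite !ffunE; case: eqP; rewrite ?addr0. Qed.

Lemma single0 k i : single i (0%R : gr LN (dS k)) = 0%R.
Proof. by apply/ffunP => j; rewrite !ffunE; case: ifP. Qed.

Lemma singleN k i (u : gr LN (dS k)) : single i (- u)%R = (- single i u)%R.
Proof. by apply/ffunP => j; rewrite !ffunE; case: eqP; rewrite ?oppr0. Qed.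

Definition img k : set {ffun 'I_n -> gr LN (dS k)} :=
  [set johnson k g | g in lcs (@IA F) k].
Arguments img k _ : clear implicits.

Lemma zsub_img k : zsub (img k).
Proof.
have [L1 LM LV] := subgroup_lcs (subgroup_IA F) k.
have LA := @lcs_IA_andre F k (deg_gt0 k).
split=> [|_ _ [f Lf <-] [g Lg <-]]; first by exists 1; rewrite ?johnson1.
exists (f * g^-1); first by apply: LM => //; apply: LV.
by rewrite johnsonM ?johnsonV //; apply: LA => //; apply: LV.
Qed.

(** The image is closed under brackets of derivations; for derivations x_c |-> p
    and x_i |-> q, each supported on one generator, the bracket is supported on
    x_i and x_c. *)
Lemma img_comm k l m D E i c p q : m = (k + l)%N :> nat ->
  lcs (@IA F) k D -> lcs (@IA F) l E -> LN (dS k) p -> LN (dS l) q ->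
  johnson k D = single c (cls LN (dS k) p) ->
  johnson l E = single i (cls LN (dS l) q) ->
  img m (single i (cls LN (dS m) (disp D q)) -
         single c (cls LN (dS m) (disp E p)))%R.
Proof.
move=> mE LD LE Lp Lq /ffunP jD /ffunP jE.
have AD := lcs_IA_andre (deg_gt0 k) LD.
have AE := lcs_IA_andre (deg_gt0 l) LE.
exists [~ D, E].
  by rewrite mE; apply: (lcs_comm (subgroup_IA F)); rewrite ?deg_gt0.
apply/ffunP => j; rewrite !ffunE.
have M1 : dS m = (deg1 + k + l)%N :> nat by rewrite /= mE add1n.
have M2 : dS m = (dS l + k)%N :> nat by rewrite /= mE addnC.
have M3 : dS m = (dS k + l)%N :> nat by rewrite /= mE.
rewrite (cls_disp_comm M1 AD AE (X1 j)).
have key (d e : degree) (f : aut F) r u (M' : degree) : M' = (dS e + d)%N :> nat -> andre d f ->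
    LN (dS e) r -> LN (dS e) u -> forall h : bool,
    cls LN (dS e) u = (if h then cls LN (dS e) r else 0%R) ->
    cls LN M' (disp f u) = if h then cls LN M' (disp f r) else 0%R.
  move=> M'E Af Lr Lu [] /= ur; first exact: (cls_disp_eq M'E Af Lu Lr ur).
  rewrite (cls_disp_eq M'E Af Lu (nterm1 LN (dS e))) ?cls1 //.
  by rewrite disp1 cls1.
have := jE j; have := jD j; rewrite !ffunE => jDj jEj.
by rewrite (key _ _ _ _ _ _ M2 AD Lq (AE (x j)) _ jEj) (key _ _ _ _ _ _ M3 AE Lp (AD (x j)) _ jDj).
Qed.

(** * Left-normed commutators of basis elements *)

Definition lnc y s : F := foldl (fun u i => [~ u, x i]) y s.

Lemma lnc_rcons y s i : lnc y (rcons s i) = [~ lnc y s, x i].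
Proof. by rewrite /lnc foldl_rcons. Qed.

Lemma lnc_cat y s t : lnc y (s ++ t) = lnc (lnc y s) t.
Proof. by rewrite /lnc foldl_cat. Qed.

Lemma lnc_in a m y s : m = (a + size s)%N :> nat -> LN a y -> LN m (lnc y s).
Proof.
elim: s a y => [|i s IH] a y mE Ly; first by apply: nterm_eqdeg Ly; rewrite mE addn0.
apply: (IH (addd a deg1)); first by rewrite mE /= addn1 addSnnS.
by apply: nterm_addd.
Qed.

Lemma lnc_gen_in (k : nat) i s : size s = k -> LN (dS k) (lnc (x i) s).
Proof. by move=> sk; apply: (@lnc_in deg1); rewrite //= sk add1n. Qed.

Definition lnc_set m y (P : pred 'I_n) (d : nat) : set (gr LN m) :=
  [set cls LN m (lnc y t) | t in [set t | size t = d /\ all P t]].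
Arguments lnc_set m y P d _ : clear implicits.

Lemma brk_lnc_span a m m' y (P : pred 'I_n) d (u : gr LN m) i :
  m' = m.+1 :> nat -> m = (a + d)%N :> nat -> LN a y -> P i ->
  zspan (lnc_set m y P d) u ->
  zspan (lnc_set m' y P d.+1) (brk m' u (cls LN deg1 (x i))).
Proof.
move=> m'E mE Ly Pi; have mE' : m' = (m + deg1)%N :> nat by rewrite m'E addn1.
apply: (zspan_min (zsub_preim (brkDl mE' _) (zsub_zspan _))).
move=> _ [t [td Pt] <-]; apply: zspan_gen; exists (rcons t i).
  by rewrite /= size_rcons td all_rcons Pi.
rewrite lnc_rcons brkE //; apply: lnc_in Ly; by rewrite td.
Qed.

(** The Jacobi identity [y, [v, x_i]] = [[y, v], x_i] - [[y, x_i], v] unwinds the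
    right argument one letter at a time, without introducing new letters. *)
Lemma comm_lnc_span a m y (P : pred 'I_n) j s :
  m = (a + (size s).+1)%N :> nat -> LN a y -> all P (j :: s) ->
  zspan (lnc_set m y P (size s).+1) (cls LN m [~ y, lnc (x j) s]).
Proof.
elim/last_ind: s a m y => [|s i IH] a m y mE Ly.
  by move=> /= Pj; apply: zspan_gen; exists [:: j].
rewrite -rcons_cons all_rcons => /andP[Pi Ps].
have Ls : LN (dS (size s)) (lnc (x j) s) by apply: lnc_gen_in.
have mE' : m = (a + dS (size s) + deg1)%N :> nat.
  by rewrite mE size_rcons /= -addnA addn1.
rewrite size_rcons lnc_rcons (cls_Jacobi mE') //.
have [_ zB] := zsub_zspan (lnc_set m y P (size s).+2); apply: zB.
  have m1 : m = (addd a (dS (size s)) + deg1)%N :> nat by [].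
  rewrite -(brkE m1) //; last exact: nterm_addd.
  apply: (@brk_lnc_span a) => //; first by rewrite mE' addn1.
  exact: IH.
have L1 : LN (addd a deg1) [~ y, x i] by apply: nterm_addd.
apply: zspan_min (IH (addd a deg1) m _ _ L1 Ps); last first.
- by rewrite mE size_rcons /= -addnA.
- move=> _ [t [td Pt] <-]; apply: zspan_gen; exists (i :: t) => //.
  by rewrite /= td Pi Pt.
exact: zsub_zspan.
Qed.

Lemma lnc_generate (d : nat) (u : gr LN (dS d)) :
  zspan [set u | exists j s, size s = d /\ u = cls LN (dS d) (lnc (x j) s)] u.
Proof.
elim: d u => [|d IH]; elim/cls_ind=> y.
  set S := [set u | _] => _; have sZ := zsub_zspan S.
  rewrite -[zspan S _]/([set y | zspan S (cls LN (dS 0) y)] y).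
  apply: (free_generated freeF).
    split=> [|z t Zz Zt|z Zz] /=; first by rewrite cls1; apply: sZ.1.
      by rewrite clsM //; apply: (zsubD sZ).
    by rewrite clsV //; apply: (zsubN sZ).
  by move=> i; apply: zspan_gen; exists i, [::].
set S := [set u | _] => Ly; have sZ := zsub_zspan S.
suff : [set y | LN (dS d.+1) y /\ zspan S (cls LN (dS d.+1) y)] y by case.
apply: Ly; split.
  split=> [|z t [Lz Zz] [Lt Zt]|z [Lz Zz]]; split.
  - exact: nterm1.
  - by rewrite cls1; apply: sZ.1.
  - exact: ntermM.
  - by rewrite clsM //; apply: (zsubD sZ).
  - exact: ntermV.
  - by rewrite clsV //; apply: (zsubN sZ).
move=> _ [{}y [z [{}Ly _ ->]]]; have mE : dS d.+1 = (dS d + deg1)%N :> nat by rewrite /= addn1.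
split; first exact: (nterm_comm_eq mE).
pose H := [set z | zspan S (cls LN (dS d.+1) [~ y, z])].
rewrite -[zspan S _]/(H z); apply: (free_generated freeF) => [|i].
  split=> [|t w Zt Zw|t Zt]; rewrite /H /=.
  - by rewrite commg1 cls1; apply: sZ.1.
  - by rewrite (cls_commMr mE) //; apply: (zsubD sZ).
  - by rewrite (cls_commVr mE) //; apply: (zsubN sZ).
rewrite /H /= -(brkE mE) //.
apply: (zspan_min (zsub_preim (brkDl mE _) (zsub_zspan S)) _ (IH _)).
move=> _ [j [s [sd ->]]]; apply: zspan_gen; exists j, (rcons s i).
by rewrite size_rcons sd lnc_rcons; split=> //; rewrite brkE //; apply: lnc_gen_in.
Qed.

(** Cut just after the first occurrence of x_i: there the commutator is
    [u, x_i] = - [x_i, u], which expands into commutators starting with x_i. *)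
Lemma lnc_start i j s : i \in j :: s ->
  zspan (lnc_set (dS (size s)) (x i) predT (size s))
    (cls LN (dS (size s)) (lnc (x j) s)).
Proof.
elim/last_ind: s => [|s h IH].
  by rewrite inE => /eqP ->; apply: zspan_gen; exists [::].
rewrite -rcons_cons mem_rcons inE size_rcons lnc_rcons.
have mE : dS (size s).+1 = (dS (size s) + deg1)%N :> nat by rewrite /= addn1.
have Ls : LN (dS (size s)) (lnc (x j) s) by apply: lnc_gen_in.
have [js _|_] := boolP (i \in j :: s).
  rewrite -(brkE mE) //; apply: (@brk_lnc_span deg1) => //.
  exact: IH.
rewrite orbF => /eqP <-.
have mE' : dS (size s).+1 = (deg1 + dS (size s))%N :> nat by [].
rewrite (cls_commC mE' (X1 i) Ls); apply: (zsubN (zsub_zspan _)).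
by apply: (@comm_lnc_span deg1) => //; apply: all_predT.
Qed.

(** A derivation that kills the letters of s commutes with the operator
    y |-> [y, s]. *)
Lemma disp_lnc a m M k f y p s : m = (a + k)%N :> nat -> M = (m + size s)%N :> nat ->
  andre k f -> (forall j, j \in s -> johnson k f j = 0%R) ->
  LN a y -> LN m p -> cls LN m (disp f y) = cls LN m p ->
  cls LN M (disp f (lnc y s)) = cls LN M (lnc p s).
Proof.
move=> mE + Af + Ly Lp yp; elim/last_ind: s M => [|s i IH] M ME fs.
  by have -> : M = m by apply: val_inj; rewrite /= ME addn0.
have bE : (0 < a + size s)%N by rewrite addn_gt0 deg_gt0.
have m'E : (0 < m + size s)%N by rewrite addn_gt0 deg_gt0.
pose b := Degree bE; pose m' := Degree m'E.
have Lb : LN b (lnc y s) by apply: lnc_in Ly.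
have Lm' : LN m' (lnc p s) by apply: lnc_in Lp.
have M1 : M = (b + deg1 + k)%N :> nat.
  by rewrite ME size_rcons /= mE; lia.
have M2 : M = (m' + deg1)%N :> nat by rewrite ME size_rcons /= addnS addn1.
have M3 : m' = (b + k)%N :> nat by rewrite /= mE addnAC.
have M4 : M = (b + dS k)%N :> nat by rewrite M1 /=; lia.
rewrite !lnc_rcons (cls_dispR M1) //.
have /fs : i \in rcons s i by rewrite mem_rcons mem_head.
rewrite ffunE => fi; have Di : LN (dS k) (disp f (x i)) by apply: Af.
rewrite -[X in (_ + X)%R](brkE M4) // fi brk0r // addr0.
rewrite -(brkE M2) //; last exact: (disp_in M3 Af).
rewrite IH ?brkE // => j js; apply: fs; by rewrite mem_rcons inE js orbT.
Qed.

(** * Derivations supported on one generator *)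

Lemma img_single_transvection i (a b y : F) :
  generated [set x j | j in [set j | j != i]] a ->
  generated [set x j | j in [set j | j != i]] b ->
  a * x i * b * (x i)^-1 = y -> LN (dS 1) y ->
  img deg1 (single i (cls LN (dS deg1) y)).
Proof.
move=> Ga Gb <- Ly; have [f [fi fj]] := transvection freeF Ga Gb.
have jf j : disp f (x j) = if j == i then a * x i * b * (x i)^-1 else 1.
  by have [->|ji] := eqVneq; rewrite /disp ?fi ?fj // mulgV.
exists f; last first.
  by apply/ffunP => j; rewrite !ffunE jf; case: eqP => _ //; apply: cls1.
apply: andre_basis => j; rewrite jf; case: eqP => // _; exact: (nterm1 LN (dS 1)).
Qed.

(** The derivation x_i |-> [x_a, x_b] is induced by the automorphism multiplying
    x_i by [x_a, x_b] if i is not a or b, and conjugating x_i by x_b if i is a. *)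
Lemma img_single_deg1 i (a b : 'I_n) :
  img deg1 (single i (cls LN (dS deg1) [~ x a, x b])).
Proof.
have sI := zsub_img deg1; have mE : dS deg1 = (deg1 + deg1)%N :> nat by [].
have [G1 GM GV] := subgroup_generated [set x j | j in [set j | j != i]].
have Gx j : j != i -> generated [set x j | j in [set j | j != i]] (x j).
  by move=> ji; apply: sub_gen_smallest; exists j.
have L u v : LN (dS deg1) [~ u, v] by apply: (nterm_comm_eq (A := LN) mE).
have conj (c : 'I_n) : c != i -> img deg1 (single i (cls LN (dS deg1) [~ x i, x c])).
  move=> ci; have -> : cls LN (dS deg1) [~ x i, x c] = cls LN (dS deg1) [~ x c, (x i)^-1].
    by rewrite (cls_commVr mE) // -(cls_commC mE).
  apply: (@img_single_transvection _ (x c)^-1 (x c)) => //; first by apply: GV; apply: Gx.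
    exact: Gx.
  by rewrite /commg /conjg invgK !mulgA.
have [ai|ai] := eqVneq a i; have [bi|bi] := eqVneq b i.
- by rewrite ai bi commgg cls1 single0; apply: sI.1.
- by rewrite ai; apply: conj.
- by rewrite bi (cls_commC mE (X1 i) (X1 a)) singleN; apply/(zsubN sI)/conj.
apply: (@img_single_transvection _ [~ x a, x b] 1) => //; last by rewrite mulg1 mulgK.
rewrite /commg /conjg; have ga := Gx a ai; have gb := Gx b bi; rewrite !mulgA.
exact: (GM _ _ (GM _ _ (GM _ _ (GV _ ga) (GV _ gb)) ga) gb).
Qed.

Lemma img_comm_witness k l m i c p q : m = (k + l)%N :> nat ->
  img k (single c (cls LN (dS k) p)) -> img l (single i (cls LN (dS l) q)) ->
  LN (dS k) p -> LN (dS l) q ->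
  exists D E, [/\ andre k D, andre l E, johnson k D = single c (cls LN (dS k) p),
    johnson l E = single i (cls LN (dS l) q) &
    img m (single i (cls LN (dS m) (disp D q)) -
           single c (cls LN (dS m) (disp E p)))%R].
Proof.
move=> mE [D LD jD] [E LE jE] Lp Lq; exists D, E.
have AD := lcs_IA_andre (deg_gt0 k) LD; have AE := lcs_IA_andre (deg_gt0 l) LE.
split=> //.
exact: img_comm LD LE Lp Lq jD jE.
Qed.

Lemma single_off k f i j (u : gr LN (dS k)) : johnson k f = single i u ->
  j != i -> johnson k f j = 0%R.
Proof. by move=> -> /negbTE ji; rewrite ffunE ji. Qed.

Lemma single_cls_disp k f i p : johnson k f = single i (cls LN (dS k) p) ->
  cls LN (dS k) (disp f (x i)) = cls LN (dS k) p.
Proof. by move=> /ffunP/(_ i); rewrite !ffunE eqxx. Qed.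

(** By induction on the degree: bracketing x_i |-> v with x_i |-> [x_i, x_a] gives
    x_i |-> [v, x_a] as long as neither v nor x_a involves x_i. *)
Lemma img_free k i j s : i \notin j :: s -> size s = k ->
  img k (single i (cls LN (dS k) (lnc (x j) s))).
Proof.
elim/last_ind: s k => [|s a IH] k; first by case: k => -[].
rewrite -rcons_cons mem_rcons inE negb_or size_rcons => /andP[ia ijs] kE.
have [s0|s_gt0] := posnP (size s).
  have -> : k = deg1 by apply: val_inj; rewrite /= -kE s0.
  by rewrite (size0nil s0); apply: img_single_deg1.
pose l := Degree s_gt0; have kE' : k = (l + deg1)%N :> nat by rewrite /= addn1.
have Ls : LN (dS l) (lnc (x j) s) by apply: lnc_gen_in.
have Lia : LN (dS deg1) [~ x i, x a] by apply: (nterm_comm_eq (A := LN) (a := deg1) (b := deg1)).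
have := img_comm_witness kE' (IH l ijs erefl) (img_single_deg1 i i a) Ls Lia.
move=> [D [E [AD AE jD jE]]].
have -> : cls LN (dS k) (disp D [~ x i, x a]) = cls LN (dS k) (lnc (x j) (rcons s a)).
  rewrite -[[~ x i, x a]]/(lnc (x i) [:: a]) -cats1 lnc_cat.
  apply: (@disp_lnc deg1 (dS l) _ l) => //.
  - by rewrite kE' /= !addn1.
  - by move=> h; rewrite inE => /eqP ->; rewrite (single_off jD) // eq_sym.
  - exact: single_cls_disp jD.
have L1 : LN (dS deg1) 1 by apply: nterm1.
have -> : cls LN (dS k) (disp E (lnc (x j) s)) = cls LN (dS k) (lnc 1 s).
  apply: (@disp_lnc deg1 (dS deg1) _ deg1) => //.
  - by rewrite /= -kE.
  - move=> h hs; rewrite (single_off jE) //; apply: contraNneq ijs => <-.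
    by rewrite inE hs orbT.
  - rewrite cls1; have ji : j != i by apply: contraNneq ijs => ->; rewrite mem_head.
    by have := single_off jE ji; rewrite ffunE.
have -> : lnc 1 s = 1 by elim: (s) => //= h t; rewrite comm1g.
by rewrite cls1 single0 subr0.
Qed.

(** Write s = s' a and bracket x_c |-> [x_i, s'] with x_i |-> [x_c, x_a]: the part
    supported on x_i is the given derivation, and the part supported on the
    fresh generator x_c substitutes [x_c, x_a] for one occurrence of x_i at a
    time, so that it is linear in x_c. However often x_i occurs in s, this leaves
    only derivations of the form x_c |-> [x_c, w] with c not in w. *)
Lemma img_move k i c s : (1 < k)%N -> c \notin i :: s -> size s = k ->
  exists2 u, zspan (lnc_set (dS k) (x c) (predC1 c) k) u &
    img k (single i (cls LN (dS k) (lnc (x i) s)) - single c u)%R.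
Proof.
case/lastP: s => [|s a]; first by move=> k1 _ /esym k0; rewrite k0 in k1.
rewrite -rcons_cons mem_rcons inE negb_or size_rcons => k1 /andP[ca cis] kE.
have s_gt0 : (0 < size s)%N by rewrite -ltnS kE.
pose l := Degree s_gt0; have kE' : k = (l + deg1)%N :> nat by rewrite /= addn1.
have Ls : LN (dS l) (lnc (x i) s) by apply: lnc_gen_in.
have Lca : LN (dS deg1) [~ x c, x a] by apply: (nterm_comm_eq (A := LN) (a := deg1) (b := deg1)).
have := img_comm_witness kE' (@img_free l c i s cis erefl) (img_single_deg1 i c a) Ls Lca.
move=> [D [E [AD AE jD jE]]].
have -> : cls LN (dS k) (disp D [~ x c, x a]) = cls LN (dS k) (lnc (x i) (rcons s a)).
  rewrite -[[~ x c, x a]]/(lnc (x c) [:: a]) -cats1 lnc_cat.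
  apply: (@disp_lnc deg1 (dS l) _ l) => //.
  - by rewrite kE' /= !addn1.
  - by move=> h; rewrite inE => /eqP ->; rewrite (single_off jD) // eq_sym.
  - exact: single_cls_disp jD.
move=> imgk; exists (cls LN (dS k) (disp E (lnc (x i) s))) => //.
have -> : k = dS (size s) by apply: val_inj; rewrite /= -kE.
have ci : c != i by move: cis; rewrite inE negb_or => /andP[].
have {cis} cs : c \notin s by move: cis; rewrite inE negb_or => /andP[].
have DE h : LN (dS deg1) (disp E (x h)) by apply: AE.
have Ei : cls LN (dS deg1) (disp E (x i)) = cls LN (dS deg1) [~ x c, x a].
  exact: single_cls_disp jE.
have Eh h : h != i -> cls LN (dS deg1) (disp E (x h)) = 0%R.
  by move=> hi; have := single_off jE hi; rewrite ffunE.
(* E acts on [x_i, s] by the Leibniz rule; each term is linear in x_c. *)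
elim/last_ind: s cs {s_gt0 l kE' Ls jD AD D imgk kE} => [|s h IH].
  by move=> _; apply: zspan_gen; exists [:: a] => //=; rewrite eq_sym ca.
rewrite mem_rcons inE negb_or size_rcons => /andP[ch cs].
have Ls : LN (dS (size s)) (lnc (x i) s) by apply: lnc_gen_in.
set m := dS (dS _).
have m1 : m = (dS (size s) + deg1 + deg1)%N :> nat by rewrite /= !addn1.
have m2 : m = (dS (dS (size s)) + deg1)%N :> nat by rewrite /= addn1.
have m3 : m = (dS (size s) + dS deg1)%N :> nat by rewrite /= !addn2.
have m4 : m = (dS deg1 + dS (size s))%N :> nat by [].
rewrite lnc_rcons (cls_dispR m1) //; apply: (zsubD (zsub_zspan _)).
  rewrite -(brkE m2) //; last by apply: (disp_in _ AE Ls); rewrite /= addn1.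
  apply: (@brk_lnc_span deg1) => //=; last exact: IH.
  by rewrite eq_sym.
rewrite -(brkE m3) //; have [->|hi] := eqVneq h i; last first.
  by rewrite Eh // brk0r //; apply: (zsub_zspan _).1.
rewrite Ei brkE // (cls_commC m4) //; apply: (zsubN (zsub_zspan _)).
have Pis : all (predC1 c) (i :: s).
  by apply/allP => g; rewrite inE => /predU1P[->|gs] /=; [rewrite eq_sym|apply: contraNneq cs => <-].
apply: zspan_min (comm_lnc_span m4 Lca Pis); first exact: zsub_zspan.
move=> _ [t [td Pt] <-]; apply: zspan_gen; exists (a :: t) => //.
by rewrite /= td Pt eq_sym ca.
Qed.

(** * Cyclic words *)

(** The derivation x_c |-> [x_c, w]; for c not in w its trace is, up to sign, the
    cyclic word w. *)
Definition word_der k c w : {ffun 'I_n -> gr LN (dS k)} :=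
  single c (cls LN (dS k) (lnc (x c) w)).

(** Bracket x_c |-> [x_i, s] with x_i |-> [x_c, t]. *)
Lemma img_swap k i c s t : i != c -> i \notin s ++ t -> c \notin s ++ t ->
  (0 < size s)%N -> (0 < size t)%N -> k = (size s + size t)%N :> nat ->
  img k (word_der k i (s ++ t) - word_der k c (t ++ s))%R.
Proof.
rewrite !mem_cat !negb_or => ic /andP[iS it] /andP[cs ct] s_gt0 t_gt0 kE.
pose d := Degree s_gt0; pose e := Degree t_gt0.
have kE' : k = (d + e)%N :> nat by [].
have cis : c \notin i :: s by rewrite inE negb_or eq_sym ic.
have ict : i \notin c :: t by rewrite inE negb_or ic.
have Ls : LN (dS d) (lnc (x i) s) by apply: lnc_gen_in.
have Lt : LN (dS e) (lnc (x c) t) by apply: lnc_gen_in.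
have := img_comm_witness kE' (@img_free d c i s cis erefl) (@img_free e i c t ict erefl) Ls Lt.
move=> [D [E [AD AE jD jE]]].
have -> : cls LN (dS k) (disp D (lnc (x c) t)) = cls LN (dS k) (lnc (x i) (s ++ t)).
  rewrite lnc_cat; apply: (@disp_lnc deg1 (dS d) _ d) => //.
  - by rewrite kE'.
  - by move=> h ht; apply: (single_off jD); apply: contraNneq ct => <-.
  - exact: single_cls_disp jD.
have -> // : cls LN (dS k) (disp E (lnc (x i) s)) = cls LN (dS k) (lnc (x c) (t ++ s)).
rewrite lnc_cat; apply: (@disp_lnc deg1 (dS e) _ e) => //.
- by rewrite /= kE' addnC.
- by move=> h hs; apply: (single_off jE); apply: contraNneq iS => <-.
- exact: single_cls_disp jE.
Qed.

(** In degree 2 moving between two generators only produces the swap of both the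
    letters and the generators; the letters alone are swapped by the commutator
    of x_i |-> [x_i, x_a] and x_i |-> [x_i, x_b]. *)
Lemma img_swap2 k i (a b : 'I_n) : k = 2 :> nat -> a != i -> b != i ->
  img k (word_der k i [:: a; b] - word_der k i [:: b; a])%R.
Proof.
move=> k2 ai bi; have kE : k = (deg1 + deg1)%N :> nat by [].
have L h : LN (dS deg1) [~ x i, x h].
  by apply: (nterm_comm_eq (A := LN) (a := deg1) (b := deg1)).
have := img_comm_witness kE (img_single_deg1 i i a) (img_single_deg1 i i b) (L a) (L b).
move=> [D [E [AD AE jD jE]]].
have -> : cls LN (dS k) (disp D [~ x i, x b]) = cls LN (dS k) (lnc (x i) [:: a; b]).
  rewrite -[[~ x i, x b]]/(lnc (x i) [:: b]) -[[:: a; b]]/([:: a] ++ [:: b]) lnc_cat.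
  apply: (@disp_lnc deg1 (dS deg1) _ deg1) => //.
  - by rewrite /= k2.
  - by move=> h; rewrite inE => /eqP ->; apply: (single_off jD).
  - exact: L.
  - exact: single_cls_disp jD.
have -> // : cls LN (dS k) (disp E [~ x i, x a]) = cls LN (dS k) (lnc (x i) [:: b; a]).
rewrite -[[~ x i, x a]]/(lnc (x i) [:: a]) -[[:: b; a]]/([:: b] ++ [:: a]) lnc_cat.
apply: (@disp_lnc deg1 (dS deg1) _ deg1) => //.
- by rewrite /= k2.
- by move=> h; rewrite inE => /eqP ->; apply: (single_off jE).
- exact: L.
- exact: single_cls_disp jE.
Qed.

Section Stable.
Variable k : degree.
Hypotheses (k_gt1 : (1 < k)%N) (kn : (k + 2 <= n)%N).

Lemma fresh s : (size s < n)%N -> exists c, c \notin s.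
Proof.
move=> sn; have [[c cs]|all_in] := pselect (exists c, c \notin s); first by exists c.
have : (size (enum 'I_n) <= size s)%N.
  apply: uniq_leq_size => [|c _]; first exact: enum_uniq.
  by apply/negPn/negP => cs; apply: all_in; exists c.
by rewrite size_enum_ord leqNgt sn.
Qed.

Definition img_eqv (u v : {ffun 'I_n -> gr LN (dS k)}) : Prop := img k (u - v)%R.

Lemma img_eqv_refl u : img_eqv u u.
Proof. by rewrite /img_eqv subrr; apply: (zsub_img k).1. Qed.

Lemma img_eqv_sym u v : img_eqv u v -> img_eqv v u.
Proof. by rewrite /img_eqv => /(zsubN (zsub_img k)); rewrite opprB. Qed.

Lemma img_eqv_trans v u u' : img_eqv u v -> img_eqv v u' -> img_eqv u u'.
Proof.
by move=> uv vu'; have := zsubD (zsub_img k) uv vu'; rewrite addrA subrK.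
Qed.

(** In degree at least 3 two swaps through a fresh generator c suffice, cutting
    off two letters and then all but one. *)
Lemma word_der_rot1 i w : i \notin w -> size w = k ->
  img_eqv (word_der k i w) (word_der k i (rot 1 w)).
Proof.
case: w => [|a [|b w]] => [_ /esym k0|_ /esym k1|iw sw];
  [by move: k_gt1; rewrite k0|by move: k_gt1; rewrite k1|].
case: w sw iw => [|e w] sw iw.
  rewrite /rot /=; apply: img_swap2; first by rewrite -sw.
    by apply: contraNneq iw => ->; rewrite !inE eqxx.
  by apply: contraNneq iw => ->; rewrite !inE eqxx orbT.
(* The bound n >= k + 2 provides c outside of the k letters and of i. *)
have [|c] := @fresh (i :: [:: a, b, e & w]).
  by rewrite [size _]/= -ltnS; move: kn; rewrite -sw /=; lia.
rewrite inE negb_or => /andP[ci cw]; set w' := e :: w in sw iw cw *.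
have mE (h : 'I_n) : h \notin [:: a, b & w'] -> h \notin w' ++ [:: a; b].
  by apply: contraNN; rewrite mem_cat !inE => /orP[->|/orP[->|->]]; rewrite ?orbT.
have ic : i != c by rewrite eq_sym.
apply: (@img_eqv_trans (word_der k c (w' ++ [:: a; b]))).
  by apply: (@img_swap _ _ _ [:: a; b] w').
have -> : w' ++ [:: a; b] = (w' ++ [:: a]) ++ [:: b] by rewrite -catA.
have -> : rot 1 [:: a, b & w'] = [:: b] ++ (w' ++ [:: a]).
  by rewrite /rot /= cats1.
apply: img_swap => //; try by rewrite -catA; apply: mE.
rewrite size_cat -sw /=; lia.
Qed.

Lemma word_der_rot i c w r : i \notin w -> c \notin w -> size w = k ->
  img_eqv (word_der k i w) (word_der k c (iter r (rot 1) w)).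
Proof.
move=> iw cw sw.
have iter_rot h r' : h \notin w ->
    img_eqv (word_der k h w) (word_der k h (iter r' (rot 1) w)).
  move=> hw; have : h \notin iter r' (rot 1) w /\ size (iter r' (rot 1) w) = k.
    by elim: r' => //= r' [IH <-]; rewrite mem_rot size_rot.
  elim: r' => [_|r' IH] /=; first exact: img_eqv_refl.
  rewrite mem_rot size_rot => -[hr sr]; apply: img_eqv_trans (IH (conj hr sr)) _.
  exact: word_der_rot1.
have [->|ic] := eqVneq i c; first exact: iter_rot.
apply: img_eqv_trans (iter_rot c r cw).
apply: (@img_eqv_trans (word_der k c (rot 1 w))); last first.
  by apply: img_eqv_sym; apply: word_der_rot1.
case: w iw cw sw {iter_rot} => [|a [|b w]] iw cw sw; try by move: k_gt1; rewrite -sw.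
rewrite /rot /= -cat1s.
by apply: (@img_swap _ _ _ [:: a] (b :: w)) => //; rewrite -sw.
Qed.

(** A monomial supported on x_i either avoids x_i, and lies in the image, or can
    be taken to start with x_i, and then moves to a fresh generator. *)
Lemma word_der_span (T : set {ffun 'I_n -> gr LN (dS k)}) : zsub T ->
  img k `<=` T -> (forall c w, size w = k -> c \notin w -> T (word_der k c w)) ->
  forall v, T v.
Proof.
move=> sT imgT wT v.
have -> : v = (\sum_i single i (v i))%R.
  apply/ffunP => j; rewrite sum_ffunE (bigD1 j) //= ffunE eqxx big1 ?addr0 // => i ij.
  by rewrite ffunE eq_sym (negbTE ij).
apply: zsub_sum => // i _.
apply: (zspan_min (zsub_preim (@singleD k i) sT) _ (lnc_generate (v i))).
move=> _ [j [s [sk ->]]] /=.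
have [|ijs] := boolP (i \in j :: s); last by apply: imgT; apply: img_free.
move=> /lnc_start; rewrite sk => Hs.
apply: (zspan_min (zsub_preim (@singleD k i) sT) _ Hs).
move=> _ [t [tk _] <-] /=.
have [|c cit] := @fresh (i :: t); first by rewrite /= tk -addn2.
have [u Hu imgu] := img_move k_gt1 cit tk.
rewrite -[single i _](subrK (single c u)); apply: (zsubD sT); first exact: imgT.
apply: (zspan_min (zsub_preim (@singleD k c) sT) _ Hu).
move=> _ [w [wk cw] <-] /=; apply: wT => //.
by apply/negP => /(allP cw); rewrite /= eqxx.
Qed.

Definition rot1 (w : k.-tuple 'I_n) : k.-tuple 'I_n := [tuple of rot 1 w].

Lemma rot1_inj : injective rot1.
Proof. by move=> u v /(congr1 val) /= /rot_inj /val_inj. Qed.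

Lemma iter_rot1 r (w : k.-tuple 'I_n) : iter r rot1 w = iter r (rot 1) w :> seq _.
Proof. by elim: r => //= r <-. Qed.

(** Modulo the image, the target is generated by one word derivation for each
    orbit of words under rotation, so a family of functionals that kills the
    image and separates the orbits detects the image. *)
Lemma img_of_traces (Tr : k.-tuple 'I_n -> {ffun 'I_n -> gr LN (dS k)} -> int) :
  (forall w : k.-tuple 'I_n, {morph Tr w : u v / (u + v)%R}) ->
  (forall (w : k.-tuple 'I_n) v, img k v -> Tr w v = 0%R) ->
  (forall c (w : k.-tuple 'I_n), c \notin tval w -> Tr w (word_der k c w) <> 0%R) ->
  (forall c (w u : k.-tuple 'I_n), c \notin tval u -> ~~ fconnect rot1 w u ->
     Tr w (word_der k c u) = 0%R) ->
  forall v, (forall w : k.-tuple 'I_n, Tr w v = 0%R) -> img k v.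
Proof.
move=> TrD Tr_img Tr_self Tr_off v Trv.
have Tr0 (w : k.-tuple 'I_n) : Tr w 0%R = 0%R by apply: (addIr (Tr w 0%R)); rewrite -TrD !add0r.
have TrN (w : k.-tuple 'I_n) u : Tr w (- u)%R = (- Tr w u)%R.
  by apply: (addIr (Tr w u)); rewrite -TrD !addNr.
have TrMz (w : k.-tuple 'I_n) u (z : int) : Tr w (u *~ z)%R = (Tr w u *~ z)%R.
  have Trn (d : nat) : Tr w (u *+ d)%R = (Tr w u *+ d)%R.
    by elim: d => [|d IH]; rewrite ?mulr0n // !mulrS TrD IH.
  by case: z => d; rewrite ?NegzE ?mulrNz ?TrN Trn.
have fr (w : k.-tuple 'I_n) : exists c, c \notin tval w.
  by apply: fresh; rewrite size_tuple; move: kn; lia.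
pose e (w : k.-tuple 'I_n) := word_der k (xchoose (fr w)) w.
have fe (w : k.-tuple 'I_n) : xchoose (fr w) \notin tval w := xchooseP (fr w).
have rsym : connect_sym (frel rot1) := fconnect_sym rot1_inj.
pose comb (m : k.-tuple 'I_n -> int) := (\sum_(u | froots rot1 u) e u *~ m u)%R.
have comb0 : comb (fun=> 0%R) = 0%R by apply: big1 => u _; apply: mulr0z.
have {}v_comb : exists h, img k (v - comb h)%R.
  move: v {Trv}; apply: word_der_span.
  - split=> [|u v [m Hu] [m' Hv]].
      by exists (fun=> 0%R); rewrite comb0 subr0; apply: (zsub_img k).1.
    exists (fun u => m u - m' u)%R; have := (zsub_img k).2 _ _ Hu Hv.
    have -> : comb (fun u => m u - m' u)%R = (comb m - comb m')%R.
      by rewrite /comb -sumrB; apply: eq_bigr => w _; rewrite mulrzBr.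
    by congr img; rewrite !opprB addrACA [RHS]addrACA; congr (_ + _)%R; rewrite addrC.
  - by move=> v imgv; exists (fun=> 0%R); rewrite comb0 subr0.
  move=> c w wk cw; pose t : k.-tuple 'I_n := Tuple (introT eqP wk).
  pose r := froot rot1 t; exists (fun u => (u == r)%:R)%R.
  have rr : froots rot1 r by apply: roots_root.
  rewrite /comb (bigD1 r) //= eqxx big1 ?addr0; last first.
    by move=> u /andP[_ /negbTE ->]; rewrite mulr0z.
  have tr : fconnect rot1 t r by apply: connect_root.
  rewrite mulr1z /e; move: (xchoose (fr r)) (fe r) => d.
  rewrite -(iter_findex tr) iter_rot1 => fw; apply: word_der_rot => //=.
  elim: (findex _ _ _) fw => //= j IH; rewrite mem_rot; exact: IH.
have [m Hm] := v_comb.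
suff m0 (w : k.-tuple 'I_n) : froots rot1 w -> m w = 0%R.
  move: Hm; rewrite /comb big1 ?subr0 // => w /m0 ->.
  by rewrite mulr0z.
move=> rw; have := Tr_img w _ Hm; rewrite TrD TrN Trv add0r => /eqP.
rewrite oppr_eq0 /comb (big_morph (Tr w) (TrD w) (Tr0 w)) (bigD1 w) //=.
rewrite TrMz big1 ?addr0 => [|u /andP[ru uw]]; last first.
  rewrite TrMz Tr_off ?mul0rz //; apply: contraNN uw => /(fingraph.rootP rsym) wu.
  by rewrite -(eqP ru) -(eqP rw) wu.
rewrite mulrzz mulf_eq0 => /orP[/eqP Tw0|/eqP //].
by case: (Tr_self _ w (fe w)).
Qed.

End Stable.
End Johnson.

(** * Fox Jacobians *)

Section FoxElements.
Variables (R : pzRingType) (m : nat).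
Local Open Scope ring_scope.

(** The group of affine maps v |-> g v + t: a homomorphism into it is the same as
    a representation together with a crossed homomorphism. *)
Record affine := Affine {
  aff_lin : 'M[R]_m; aff_inv : 'M[R]_m; aff_trans : 'M[R]_m;
  aff_linK : aff_lin *m aff_inv = 1%:M;
  aff_invK : aff_inv *m aff_lin = 1%:M }.

Implicit Types u v w : affine.

Lemma affine_eq u v :
  aff_lin u = aff_lin v -> aff_trans u = aff_trans v -> u = v.
Proof.
case: u => g g' t gg' g'g; case: v => h h' s hh' h'h /= gh ts; subst h s.
have {}gh : g' = h' by rewrite -[g']mulmx1 -hh' mulmxA g'g mul1mx.
by subst h'; congr Affine; apply: Prop_irrelevance.
Qed.

HB.instance Definition _ := gen_eqMixin affine.
HB.instance Definition _ := gen_choiceMixin affine.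

Definition aff_one := Affine 0 (mulmx1 _) (mulmx1 (1%:M : 'M[R]_m)).

Lemma aff_mulK u v :
  (aff_lin u *m aff_lin v) *m (aff_inv v *m aff_inv u) = 1%:M.
Proof. by rewrite mulmxA -[X in X *m _]mulmxA aff_linK mulmx1 aff_linK. Qed.
Lemma aff_mulVK u v :
  (aff_inv v *m aff_inv u) *m (aff_lin u *m aff_lin v) = 1%:M.
Proof. by rewrite mulmxA -[X in X *m _]mulmxA aff_invK mulmx1 aff_invK. Qed.

Definition aff_mul u v :=
  Affine (aff_trans u + aff_lin u *m aff_trans v) (aff_mulK u v) (aff_mulVK u v).
Definition aff_invg u :=
  Affine (- (aff_inv u *m aff_trans u)) (aff_invK u) (aff_linK u).

Lemma aff_mulA : associative aff_mul.
Proof.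
by move=> u v w; apply: affine_eq; rewrite /= ?mulmxA // mulmxDr addrA mulmxA.
Qed.
Lemma aff_mul1 : left_id aff_one aff_mul.
Proof. by move=> u; apply: affine_eq; rewrite /= ?mul1mx // add0r. Qed.
Lemma aff_mulr1 : right_id aff_one aff_mul.
Proof. by move=> u; apply: affine_eq; rewrite /= ?mulmx1 // mulmx0 addr0. Qed.
Lemma aff_mulV : left_inverse aff_one aff_invg aff_mul.
Proof. by move=> u; apply: affine_eq; rewrite /= ?aff_invK // addNr. Qed.
Lemma aff_mulrV : right_inverse aff_one aff_invg aff_mul.
Proof.
move=> u; apply: affine_eq; rewrite /= ?aff_linK // mulmxN mulmxA aff_linK.
by rewrite mul1mx addrN.
Qed.
HB.instance Definition _ := isGroup.Build affine
  aff_mulA aff_mul1 aff_mulr1 aff_mulV aff_mulrV.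

Variable F : groupType.
Implicit Types (P d : F -> 'M[R]_m).

Definition is_rep P := P 1%g = 1%:M /\ forall a b, P (a * b)%g = P a *m P b.

Definition crossed P d := forall a b, d (a * b)%g = d a + P a *m d b.

Lemma rep_mulV P a : is_rep P -> P a *m P a^-1%g = 1%:M.
Proof. by move=> [P1 PM]; rewrite -PM mulgV. Qed.
Lemma rep_Vmul P a : is_rep P -> P a^-1%g *m P a = 1%:M.
Proof. by move=> [P1 PM]; rewrite -PM mulVg. Qed.

Lemma crossed1 P d : is_rep P -> crossed P d -> d 1%g = 0.
Proof.
move=> [P1 _] dM; have := dM 1%g 1%g; rewrite mulg1 P1 mul1mx.
by move=> /(congr1 (fun z => z - d 1%g)); rewrite addrK subrr.
Qed.

Lemma crossedV P d a : is_rep P -> crossed P d -> d a^-1%g = - (P a^-1%g *m d a).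
Proof.
move=> rP dM; have := dM a^-1%g a; rewrite mulVg (crossed1 rP dM).
by move=> /eqP; rewrite eq_sym addr_eq0 => /eqP.
Qed.

Variables (n : nat) (x : 'I_n -> F).
Hypothesis freeF : free_basis x.

Lemma rep_exists (A A' : 'I_n -> 'M[R]_m) :
  (forall i, A i *m A' i = 1%:M) -> (forall i, A' i *m A i = 1%:M) ->
  exists2 P, is_rep P & forall i, P (x i) = A i.
Proof.
move=> AA' A'A.
have [f fM fx] := free_hom freeF (fun i => Affine 0 (AA' i) (A'A i)).
have f1 : f 1%g = 1%g by apply: (mulgI (f 1%g)); rewrite -fM !mulg1.
exists (fun y => aff_lin (f y)) => [|i]; last by rewrite fx.
by split=> [|a b]; rewrite ?f1 ?fM.
Qed.

Lemma crossed_exists P (t : 'I_n -> 'M[R]_m) : is_rep P ->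
  exists2 d, crossed P d & forall i, d (x i) = t i.
Proof.
move=> rP.
have [f fM fx] := free_hom freeF
  (fun i => Affine (t i) (rep_mulV (x i) rP) (rep_Vmul (x i) rP)).
have fP y : aff_lin (f y) = P y.
  have f1 : f 1%g = 1%g by apply: (mulgI (f 1%g)); rewrite -fM !mulg1.
  rewrite -[LHS]/(aff_lin _); apply: (free_generated freeF (H := [set y | aff_lin (f y) = P y])).
    split=> [|a b /= fa fb|a /= fa]; rewrite /= ?f1 ?rP.1 ?fM ?rP.2 /= ?fa ?fb //.
    rewrite -[LHS]mulmx1 -(rep_mulV a rP) mulmxA -fa.
    have := congr1 aff_lin (fM a^-1%g a); rewrite mulVg f1 /= => <-.
    by rewrite mul1mx.
  by move=> i; rewrite /= fx.
exists (fun y => aff_trans (f y)) => [a b|i]; last by rewrite fx.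
by rewrite fM /= fP.
Qed.

Lemma crossed_ext P d d' : is_rep P -> crossed P d -> crossed P d' ->
  (forall i, d (x i) = d' (x i)) -> forall y, d y = d' y.
Proof.
move=> rP dM d'M dd'; apply: (free_generated freeF (H := [set y | d y = d' y])) => //.
split=> [|a b /= da db|a /= da] /=; first by rewrite (crossed1 rP dM) (crossed1 rP d'M).
  by rewrite dM d'M da db.
by rewrite (crossedV _ rP dM) (crossedV _ rP d'M) da.
Qed.

(** The Fox derivatives attached to P: crossed homomorphisms dual to the basis. *)
Definition fox P (d : 'I_n -> F -> 'M[R]_m) :=
  (forall c, crossed P (d c)) /\
  (forall c i, d c (x i) = if i == c then 1%:M else 0).

Lemma fox_exists P : is_rep P -> exists e, fox P e.
Proof.
move=> rP; have H c := cid2 (crossed_exists (fun i => if i == c then 1%:M else 0) rP).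
by exists (fun c => s2val (H c)); split=> c; case: (H c).
Qed.

Definition jacobian (d : 'I_n -> F -> 'M[R]_m) (f : F -> F) :
    'M[R]_(\sum_(i < n) m) :=
  \mxblock_(b < n, c < n) d c (f (x b)).

(** Chain rule: the Jacobian of an automorphism is inverted by that of the
    inverse automorphism, taken with respect to the twisted representation. *)
Lemma jacobian_unit P (d : 'I_n -> F -> 'M[R]_m) (f : aut F) : is_rep P -> fox P d ->
  exists J', J' *m jacobian d f = 1%:M.
Proof.
move=> rP [dM dx]; pose P' y := P (f y).
have rP' : is_rep P' by rewrite /P'; split=> [|a b]; rewrite ?autf1 ?autfM ?rP.1 ?rP.2.
have [d' [d'M d'x]] := fox_exists rP'.
have chain c y : d c (f y) = \sum_b d' b y *m d c (f (x b)).
  apply: (@crossed_ext P' (fun y => d c (f y))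
    (fun y => \sum_b d' b y *m d c (f (x b)))) => // [a b|a b|i].
  - by rewrite autfM dM.
  - by rewrite mulmx_sumr -big_split; apply: eq_bigr => j _; rewrite d'M mulmxDl mulmxA.
  rewrite (bigD1 i) //= d'x eqxx mul1mx big1 ?addr0 // => j ji.
  by rewrite d'x eq_sym (negbTE ji) mul0mx.
exists (jacobian d' (f^-1 : aut F)%g); rewrite /jacobian mul_mxblock.
rewrite -(mxdiagZ (p_ := fun=> m)) /mxdiag; apply: eq_mxblock => a c.
rewrite -chain -autME mulgV aut1E dx; case: eqP => // _; by rewrite conform_mx_id.
Qed.

End FoxElements.

Section UnitTrace.
Local Open Scope ring_scope.
Local Notation Zt := {poly int}.

Definition coef0mx m p (M : 'M[Zt]_(m, p)) : 'M[int]_(m, p) := map_mx (coefp 0) M.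

Lemma prod_1X (k N : nat) (a : 'I_N -> Zt) :
  exists b, \prod_i (1 + 'X^k * a i) = 1 + 'X^k * (\sum_i a i) + 'X^(k + k) * b.
Proof.
apply: (big_ind2 (fun p s => exists b, p = 1 + 'X^k * s + 'X^(k + k) * b)).
- by exists 0; rewrite !mulr0 !addr0.
- move=> p s p' s' [b ->] [b' ->].
  exists (b * (1 + 'X^k * s' + 'X^(k + k) * b') + s * s' + 'X^k * s * b' + b').
  rewrite exprD; ring.
by move=> i _; exists 0; rewrite mulr0 addr0.
Qed.

(** A unit of Z[t] is constant, so the first-order term of the determinant of
    1 + t^k M vanishes. *)
Lemma trace_of_unit (k N : nat) (M J' : 'M[Zt]_N) : (0 < k)%N ->
  J' *m (1%:M + 'X^k *: M) = 1%:M -> \tr (coef0mx M) = 0.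
Proof.
move=> k0 JM; set A := 1%:M + _ in JM.
have kk : (k < k + k)%N by rewrite -[X in (X < _)%N]addn0 ltn_add2l.
have detk : (\det A)`_k = 0.
  have : \det A \is a GRing.unit.
    by apply/unitrPr; exists (\det J'); rewrite mulrC -det_mulmx JM det1.
  rewrite poly_unitE => /andP[/eqP s1 _]; apply: nth_default; by rewrite s1.
rewrite -detk /determinant (bigD1 (1%g : 'S_N)) //= odd_perm1 expr0 mul1r coefD coef_sum.
have -> : \prod_i A i ((1 : 'S_N)%g i) = \prod_i (1 + 'X^k * M i i).
  by apply: eq_bigr => i _; rewrite perm1 !mxE eqxx.
have [b ->] := prod_1X k (fun i => M i i).
rewrite !coefD coef1 eqn0Ngt k0 add0r !coefXnM ltnn subnn kk addr0.
rewrite [X in _ + X]big1 ?addr0 => [|s s1]; last first.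
  (* A nontrivial permutation moves two indices, hence contributes in order 2k. *)
  have [i si] : exists i, s i != i.
    by apply/existsP; apply: contraR s1 => /existsPn H; apply/eqP/permP => i;
       rewrite perm1; apply/eqP; have := H i; rewrite negbK.
  have ssi : s (s i) != s i by rewrite (inj_eq perm_inj).
  rewrite (bigD1 i) //= (bigD1 (s i)) //= !mxE eq_sym (negbTE si) eq_sym (negbTE ssi).
  rewrite !add0r; set r := \prod_(_ | _) _.
  have -> : (-1) ^+ s * ('X^k * M i (s i) * ('X^k * M (s i) (s (s i)) * r)) =
     'X^(k + k) * ((-1) ^+ s * M i (s i) * M (s i) (s (s i)) * r).
    rewrite exprD; move: ((-1) ^+ s) ('X^k) (M i (s i)) (M (s i) (s (s i))) r.
    by move=> e p q r h; ring.
  by rewrite coefXnM kk.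
rewrite /mxtrace coef_sum; apply: eq_bigr => i _; by rewrite !mxE.
Qed.

End UnitTrace.

(** * Fox derivatives along the lower central series *)

Section FoxOrder.
Local Open Scope ring_scope.
Local Notation Zt := {poly int}.
Variables (F : groupType) (n : nat) (x : 'I_n -> F) (m : nat).
Hypothesis freeF : free_basis x.
Variable P : F -> 'M[Zt]_m.
Hypotheses (rP : is_rep P)
  (P_basis : forall i, exists U : 'M[Zt]_m, P (x i) = 1%:M + 'X *: U).
Local Notation LN := (lcs_nseries (subgroup_setT F)).
Implicit Types (U D : 'M[Zt]_m) (y z u : F).

Definition coefmx (k : nat) (M : 'M[Zt]_m) : 'M[int]_m := map_mx (coefp k) M.

Lemma coefmxXn k D : coefmx k ('X^k *: D) = coef0mx D.
Proof. by apply/matrixP => i j; rewrite !mxE /coefp coefXnM ltnn subnn. Qed.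

Lemma coefmxXn0 k l D : (k < l)%N -> coefmx k ('X^l *: D) = 0.
Proof. by move=> kl; apply/matrixP => i j; rewrite !mxE /coefp coefXnM kl. Qed.

Lemma rep_order_subgroup (k : nat) :
  subgroup [set u | exists U, P u = 1%:M + 'X^k *: U].
Proof.
case: (rP) => P1 PM; split=> [|y z [U yU] [V zV]|y [U yU]] /=.
- by exists 0; rewrite scaler0 addr0.
- exists (U + V + 'X^k *: (U *m V)); rewrite PM yU zV mulmxDl mul1mx mulmxDr mulmx1.
  by rewrite -scalemxAl -scalemxAr !scalerDr !addrA; congr (_ + _); rewrite addrAC.
exists (- (P y^-1%g *m U)); have := rep_Vmul y rP; rewrite yU mulmxDr mulmx1.
by move=> /(canRL (addrK _)) {1}->; rewrite scalerN scalemxAr.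
Qed.

(** P[u, y] - 1 is a unit times the ring commutator of P(u) - 1 and P(y) - 1, so
    that orders in t add up. *)
Lemma rep_order (a : degree) u : LN a u -> exists U, P u = 1%:M + 'X^a *: U.
Proof.
case: a u => -[//|a] a0 /=; rewrite /= {a0}.
have base y : exists U, P y = 1%:M + 'X *: U.
  have := rep_order_subgroup 1; rewrite expr1 => sH.
  exact: (free_generated freeF sH).
elim: a => [|a IH] u; first by rewrite expr1.
suff sub : lcs [set: F] a.+2 `<=` [set u | exists U, P u = 1%:M + 'X^(a.+2) *: U] by apply: sub.
apply: smallest_sub; first exact: rep_order_subgroup.
move=> _ [{}u [y [Lu _ ->]]]; have [U uU] := IH u Lu; have [Y yY] := base y.
case: (rP) => P1 PM; pose c : F := [~ u, y]%g.
have -> : [~ u, y]%g = ((y * u)^-1 * (u * y))%g by rewrite /commg /conjg invgM !mulgA.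
set w := (y * u)%g; exists (P w^-1%g *m (U *m Y - Y *m U)).
have {1}-> : 1%:M = P w^-1%g *m P w by rewrite rep_Vmul.
rewrite !PM scalemxAr -mulmxDr; congr (_ *m _).
rewrite uU yY !mulmxDl !mulmxDr !mul1mx !mulmx1.
rewrite -!scalemxAl -!scalemxAr !scalerA -exprSr -exprS scalerBr.
rewrite -[RHS]addrA [X in _ = _ + X]addrACA subrr addr0.
by rewrite addrACA.
Qed.

Section Crossed.
Variable d : F -> 'M[Zt]_m.
Hypothesis dM : crossed P d.

Lemma crossed_comm y u :
  P (y * u)%g *m d [~ u, y]%g = (P u - 1%:M) *m d y - (P y - 1%:M) *m d u.
Proof.
have : d (y * u * [~ u, y])%g = d (u * y)%g.
  by congr d; rewrite /commg /conjg !mulgA mulgK mulgV mul1g.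
rewrite 2!dM (dM u y) => /(canRL (addKr _)) ->.
rewrite !mulmxBl !mul1mx opprD opprB [d u + _]addrC addrACA.
by congr (_ + _); rewrite addrC.
Qed.

Lemma crossed_order_subgroup (k : nat) :
  subgroup [set u | exists D, d u = 'X^k *: D].
Proof.
split=> [|y z [D yD] [E zE]|y [D yD]] /=.
- by exists 0; rewrite (crossed1 rP dM) scaler0.
- by exists (D + P y *m E); rewrite dM yD zE -scalemxAr scalerDr.
by exists (- (P y^-1%g *m D)); rewrite (crossedV _ rP dM) yD -scalemxAr scalerN.
Qed.

(** A crossed homomorphism loses one power of t, its values on the generators
    being arbitrary. *)
Lemma crossed_order (k : nat) u : LN (dS k) u -> exists D, d u = 'X^k *: D.
Proof.
elim: k u => [|k IH] u; first by exists (d u); rewrite scale1r.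
suff sub : lcs [set: F] k.+2 `<=` [set u | exists D, d u = 'X^(k.+1) *: D] by apply: sub.
apply: smallest_sub; first exact: crossed_order_subgroup.
move=> _ [{}u [y [Lu _ ->]]]; have [U uU] := rep_order (a := dS k) Lu.
have [D uD] := IH u Lu; have [Y yY] := rep_order (a := deg1) (I : LN deg1 y).
exists (P (y * u)^-1%g *m (U *m d y - Y *m D)).
rewrite -[LHS]mul1mx -(rep_Vmul (y * u)%g rP) -mulmxA crossed_comm uU yY uD.
rewrite ![1%:M + _]addrC !addrK -!scalemxAl -!scalemxAr expr1 scalerA -exprS.
by rewrite -scalerBr scalemxAr.
Qed.

Lemma coef_crossedM (k : nat) y z : LN (dS k) y -> LN (dS k) z ->
  coefmx k (d (y * z)%g) = coefmx k (d y) + coefmx k (d z).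
Proof.
move=> Ly Lz; have [U yU] := rep_order Ly.
rewrite dM yU mulmxDl mul1mx -scalemxAl /coefmx !raddfD /= -!/(coefmx _ _).
by rewrite coefmxXn0 // addr0.
Qed.

Lemma coef_crossed0 (k : nat) y : LN (dS k).+1 y -> coefmx k (d y) = 0.
Proof. by move=> /(@crossed_order k.+1) [D ->]; apply: coefmxXn0. Qed.

Lemma coef_crossed_repr (k : nat) y : LN (dS k) y ->
  coefmx k (d (gr_repr (cls LN (dS k) y))) = coefmx k (d y).
Proof.
move=> Ly; have Lyr : LN (dS k).+1 (y^-1 * gr_repr (cls LN (dS k) y))%g.
  by rewrite (clsE Ly); apply: gr_repr_class.
rewrite -{1}[gr_repr _](mulVKg y) coef_crossedM ?(coef_crossed0 Lyr) ?addr0 //.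
exact: ntermS.
Qed.

End Crossed.

(** Satoh's trace, evaluated on the cyclic words in the first-order terms of the
    matrices P(x_i). *)
Definition fox_trace (d : 'I_n -> F -> 'M[Zt]_m) (k : degree)
    (v : {ffun 'I_n -> gr LN (dS k)}) : int :=
  \sum_i \tr (coefmx k (d i (gr_repr (v i)))).

Variable d : 'I_n -> F -> 'M[Zt]_m.
Hypothesis foxd : fox x P d.

Lemma fox_traceD k : {morph @fox_trace d k : u v / u + v}.
Proof.
move=> u v; rewrite /fox_trace -big_split; apply: eq_bigr => i _; rewrite /= ffunE -mxtraceD.
congr (\tr _); elim/cls_ind: (u i) => y Ly; elim/cls_ind: (v i) => z Lz.
rewrite -clsM // !(coef_crossed_repr (foxd.1 i)) ?coef_crossedM //; first exact: foxd.1.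
exact: ntermM.
Qed.

(** The Jacobian of an element of the k-th filtration step is 1 + t^k M, and the
    trace of its image under the Johnson homomorphism is the constant term of
    the trace of M. *)
Lemma fox_trace_johnson (k : degree) (f : aut F) : andre k f ->
  fox_trace d (johnson x k f) = 0.
Proof.
move=> Af; have Lf i : LN (dS k) (disp f (x i)) by apply: Af.
have H i := cid (rep_order (Lf i)); have H' i c := cid (crossed_order (foxd.1 c) (Lf i)).
pose U i := projT1 (H i); pose D i c := projT1 (H' i c).
have UE i : P (disp f (x i)) = 1%:M + 'X^(k.+1) *: U i := projT2 (H i).
have DE i c : d c (disp f (x i)) = 'X^k *: D i c := projT2 (H' i c).
pose M := \mxblock_(b < n, c < n) (D b c + 'X *: (U b *m d c (x b))).
have JE : jacobian x d f = 1%:M + 'X^k *: M.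
  have -> : 'X^k *: M = \mxblock_(b < n, c < n) ('X^k *: (D b c + 'X *: (U b *m d c (x b)))).
    by apply/matrixP => p q; rewrite !mxE.
  rewrite -(mxdiagZ (p_ := fun=> m)) /mxdiag -mxblockD; apply: eq_mxblock => b c.
  have -> : f (x b) = (disp f (x b) * x b)%g by rewrite mulgVK.
  rewrite foxd.1 DE UE mulmxDl mul1mx scalerDr scalerA -exprSr -scalemxAl.
  by rewrite foxd.2 conform_mx_id addrCA.
have [J' J'J] := jacobian_unit freeF f rP foxd.
rewrite JE in J'J; have := trace_of_unit (deg_gt0 k) J'J.
have -> : coef0mx M = \mxblock_(b < n, c < n) coef0mx (D b c + 'X *: (U b *m d c (x b))).
  by apply/matrixP => p q; rewrite !mxE.
rewrite mxtrace_mxblock => <-; apply: eq_bigr => i _; congr (\tr _).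
rewrite ffunE (coef_crossed_repr (foxd.1 i)) // DE coefmxXn.
apply/matrixP => p q; rewrite !mxE /coefp coefD coefXM eqxx addr0 //.
Qed.

Variable N : 'I_n -> 'M[int]_m.
Hypothesis P_coef : forall i U, P (x i) = 1%:M + 'X *: U -> coef0mx U = N i.

(** As the letter a differs from c, the derivative of [u, x_a] with respect to x_c
    is that of u multiplied by 1 - P(x_a), to leading order. *)
Lemma coef_fox_lnc c s : c \notin s ->
  exists2 D, d c (lnc x (x c) s) = 'X^(size s) *: D &
    coef0mx D = (-1) ^+ size s *: foldl (fun B a => N a *m B) 1%:M s.
Proof.
have coefM A B : coef0mx (A *m B) = coef0mx A *m coef0mx B by rewrite /coef0mx map_mxM.
elim/last_ind: s => [_|s a IH].
  exists 1%:M; first by rewrite /= scale1r foxd.2 eqxx.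
  by rewrite scale1r /coef0mx map_mx1.
rewrite mem_rcons inE negb_or => /andP[ca cs].
have ca' : a != c by rewrite eq_sym.
have [D sD D0] := IH cs.
have [U aU] := P_basis a; set u := lnc x (x c) s.
have [W wW] : exists W, P (x a * u)%g = 1%:M + 'X *: W.
  by have [W] := rep_order (a := deg1) (I : LN deg1 (x a * u)%g); rewrite expr1; exists W.
have Lu : LN (dS (size s)) u by apply: lnc_gen_in.
have Lua : LN (dS (size s).+1) [~ u, x a]%g.
  by apply: (nterm_comm_eq (A := LN) (a := dS (size s)) (b := deg1)); rewrite //= addn1.
have [E uE] := crossed_order (foxd.1 c) Lua.
exists E; first by rewrite lnc_rcons size_rcons.
have comm := crossed_comm (foxd.1 c) (x a) u.
rewrite foxd.2 (negbTE ca') mulmx0 sub0r aU [1%:M + _]addrC addrK sD uE wW in comm.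
rewrite -scalemxAr -scalemxAl -!scalemxAr scalerA -exprS -scalerN in comm.
have := congr1 (coefmx (size s).+1) comm; rewrite !coefmxXn mulmxDl mul1mx -scalemxAl.
have coefD A B : coef0mx (A + B) = coef0mx A + coef0mx B :> 'M[int]_m.
  by rewrite /coef0mx raddfD.
have coefN A : coef0mx (- A) = - coef0mx A :> 'M[int]_m by rewrite /coef0mx raddfN.
have coefX A : coef0mx ('X *: A) = 0 :> 'M[int]_m.
  by apply/matrixP => p q; rewrite !mxE /coefp coefXM.
rewrite coefD coefX addr0 coefN coefM => ->; rewrite (P_coef aU) D0 size_rcons foldl_rcons.
by rewrite -scalemxAr -scaleN1r scalerA -exprS.
Qed.

End FoxOrder.

(** * Detecting cyclic words by unipotent representations *)

Section WordTrace.
Local Open Scope ring_scope.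
Local Notation Zt := {poly int}.
Variables (F : groupType) (n : nat) (x : 'I_n -> F).
Hypothesis freeF : free_basis x.
Variable k : degree.
Hypothesis k_gt1 : (1 < k)%N.
Local Notation LN := (lcs_nseries (subgroup_setT F)).
Variable w : k.-tuple 'I_n.

Lemma ordS_neq (j : 'I_k) : ordS j != j.
Proof.
apply/eqP => /(congr1 val) /=; have jk := ltn_ord j.
have [jk'|kj] := ltnP j.+1 k; first by rewrite modn_small //; lia.
have -> : j.+1 = k :> nat by lia.
by rewrite modnn; move: k_gt1; lia.
Qed.

Lemma iter_ordS (j : 'I_k) r : iter r (@ordS k) j = ((j + r) %% k)%N :> nat.
Proof.
elim: r => [|r IH]; first by rewrite addn0 modn_small.
by rewrite /= IH -addn1 modnDml addn1 addnS.
Qed.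

Definition edge_mx (j : 'I_k) : 'M[Zt]_k := delta_mx (ordS j) j.

Lemma edge_mx_sq j : edge_mx j *m edge_mx j = 0.
Proof. by rewrite /edge_mx mul_delta_mx_0 // eq_sym ordS_neq. Qed.

Lemma edge_unit (e : Zt) j :
  (1%:M + e *: edge_mx j) *m (1%:M - e *: edge_mx j) = 1%:M.
Proof.
rewrite mulmxDl !mulmxBr !mulmx1 mul1mx -scalemxAl -scalemxAr edge_mx_sq.
by rewrite !scaler0 subr0 subrK.
Qed.

Lemma edge_unit' (e : Zt) j :
  (1%:M - e *: edge_mx j) *m (1%:M + e *: edge_mx j) = 1%:M.
Proof. by have := edge_unit (- e) j; rewrite scaleNr opprK. Qed.

Definition edge (j : 'I_k) : affine Zt k :=
  Affine 0 (edge_unit 'X j) (edge_unit' 'X j).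

(** The generator x_i acts by the product of the elementary matrices
    1 + t E_(j+1, j) over the positions j of the letter i in the word, the
    positions being taken cyclically; as k > 1 these are invertible over Z[t]. *)
Definition word_affine i : affine Zt k :=
  \big[*%g/1%g]_(j | tnth w j == i) edge j.

Definition word_mx i : 'M[int]_k := \sum_(j | tnth w j == i) delta_mx (ordS j) j.

Lemma word_affineE i :
  exists2 U, aff_lin (word_affine i) = 1%:M + 'X *: U & coef0mx U = word_mx i.
Proof.
apply: (big_ind2 (fun (g : affine Zt k) s =>
  exists2 U, aff_lin g = 1%:M + 'X *: U & coef0mx U = s)).
- by exists 0; rewrite ?scaler0 ?addr0 // /coef0mx map_mx0.
- move=> g s h t [U gU <-] [V hV <-]; exists (U + V + 'X *: (U *m V)).
    rewrite /= gU hV mulmxDl mul1mx mulmxDr mulmx1 -scalemxAl -scalemxAr !scalerDr !addrA.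
    by congr (_ + _); rewrite addrAC.
  rewrite /coef0mx !raddfD /= -[RHS]addr0; congr (_ + _).
  by apply/matrixP => p q; rewrite !mxE /coefp coefXM.
move=> j _; exists (edge_mx j) => //.
by apply/matrixP => p q; rewrite !mxE /coefp; case: (_ && _); rewrite ?coef1 ?coef0.
Qed.

Lemma word_mx_act i (B : 'M[int]_k) (p j q : 'I_k) :
  (forall r, B r j = (r == q)%:R * B q j) ->
  (word_mx i *m B) p j = ((p == ordS q) && (i == tnth w q))%:R * B q j.
Proof.
move=> Bq; rewrite mxE (bigD1 q) //= [X in _ + X]big1 ?addr0 => [|r rq]; last first.
  by rewrite Bq (negbTE rq) mul0r mulr0.
congr (_ * _); rewrite /word_mx summxE.
have [<-|iq] := eqVneq (tnth w q) i.
  rewrite (bigD1 q) //= mxE !eqxx andbT big1 ?addr0 ?andbT // => r /andP[_ rq].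
  by rewrite mxE [q == r]eq_sym (negbTE rq) andbF.
rewrite andbF big1 // => r /eqP ri; rewrite mxE.
by have [qr|_] := eqVneq q r; rewrite ?andbF //; rewrite qr ri eqxx in iq.
Qed.

(** The product of these matrices over a word u follows the letters of w around
    the cycle. *)
Lemma word_mx_foldl s (p j : 'I_k) :
  foldl (fun B a => word_mx a *m B) 1%:M s p j =
  ((p == iter (size s) (@ordS k) j) &&
   (s == [seq tnth w (iter r (@ordS k) j) | r <- iota 0 (size s)]))%:R.
Proof.
elim/last_ind: s p => [|s a IH] p; first by rewrite /= mxE andbT.
rewrite foldl_rcons (word_mx_act _ _ (q := iter (size s) (@ordS k) j)); last first.
  by move=> r; rewrite !IH eqxx -natrM mulnb.
rewrite IH eqxx /= size_rcons iterS -natrM mulnb -andbA; congr ((_ && _)%:R).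
by rewrite -addn1 iotaD map_cat /= cats1 add0n eqseq_rcons andbC.
Qed.

Lemma cyclic_read (j : 'I_k) :
  [seq tnth w (iter r (@ordS k) j) | r <- iota 0 k] = iter j (rot 1) w.
Proof.
(* The k-fold reading of w from position j is the rotation of w by j. *)
have -> : iter j (rot 1) w = rot j w.
  elim: (j : nat) (ltnW (ltn_ord j)) => [|r IH] rk; first by rewrite rot0.
  by rewrite iterS IH ?(ltnW rk) // -rotS // size_tuple.
pose a := tnth w j; apply: (@eq_from_nth _ a).
  by rewrite size_map size_iota size_rot size_tuple.
rewrite size_map size_iota => r rk.
rewrite (nth_map 0%N) ?size_iota // nth_iota // add0n (tnth_nth a) iter_ordS.
rewrite /rot nth_cat size_drop size_tuple nth_drop; have jk := ltn_ord j.
case: ltnP => h; first by rewrite modn_small //; lia.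
rewrite nth_take; last lia.
have kjr : (k <= j + r)%N by lia.
by rewrite -(subnK kjr) modnDr modn_small; [congr nth|]; lia.
Qed.

Lemma trace_word_mx (u : seq 'I_n) : size u = k ->
  \tr (foldl (fun B a => word_mx a *m B) 1%:M u) =
    \sum_(j < k) (u == iter j (rot 1) w)%:R.
Proof.
move=> uk; apply: eq_bigr => j _; rewrite word_mx_foldl uk cyclic_read.
have -> : iter k (@ordS k) j = j.
  by apply: val_inj; rewrite [LHS]iter_ordS modnDr modn_small.
by rewrite eqxx.
Qed.

Lemma word_trace_exists :
  exists Tr : {ffun 'I_n -> gr LN (dS k)} -> int,
  [/\ {morph Tr : u v / u + v},
      forall f, andre k f -> Tr (johnson x k f) = 0 &
      forall c (u : seq 'I_n), c \notin u -> size u = k ->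
        Tr (word_der x k c u) =
          (-1) ^+ k * \sum_(j < k) (u == iter j (rot 1) w)%:R].
Proof.
have [P rP Px] := rep_exists freeF (fun i => aff_linK (word_affine i))
                                   (fun i => aff_invK (word_affine i)).
have P_basis i : exists U : 'M[Zt]_k, P (x i) = 1%:M + 'X *: U.
  by rewrite Px; have [U -> _] := word_affineE i; exists U.
have P_coef i U : P (x i) = 1%:M + 'X *: U -> coef0mx U = word_mx i.
  rewrite Px; have [V -> <-] := word_affineE i; rewrite -['X]expr1 => /addrI.
  by move=> /(congr1 (coefmx 1)); rewrite !coefmxXn.
have [d foxd] := fox_exists freeF rP.
exists (fox_trace d (k := k)); split=> [|f Af|c u cu uk].
- exact: (fox_traceD freeF rP P_basis foxd).
- exact: (fox_trace_johnson freeF rP P_basis foxd).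
have [D uD D0] := coef_fox_lnc freeF rP P_basis foxd P_coef cu.
rewrite /fox_trace (bigD1 c) //= ffunE eqxx.
have Lu : LN (dS k) (lnc x (x c) u) by apply: lnc_gen_in.
rewrite (coef_crossed_repr freeF rP P_basis (foxd.1 c) Lu) uD uk coefmxXn D0 uk.
rewrite mxtraceZ trace_word_mx // [X in _ + X]big1 ?addr0 // => i ic.
rewrite ffunE (negbTE ic) -(cls1 LN) (coef_crossed_repr freeF rP P_basis (foxd.1 i) (nterm1 LN (dS k))).
rewrite (crossed1 rP (foxd.1 i)); apply/eqP; rewrite -[X in _ == X](mxtrace0 _ k); apply/eqP.
by congr (\tr _); apply/matrixP => p q; rewrite !mxE /coefp coef0.
Qed.

End WordTrace.

(** * Surjectivity *)

Section Surjectivity.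
Variables (F : groupType) (n : nat) (x : 'I_n -> F).
Hypothesis freeF : free_basis x.
Variable k : degree.
Hypothesis kn : (k + 2 <= n)%N.

(** The traces attached to all words of length k satisfy the requirements of
    img_of_traces: they vanish on the whole of A[k], so in particular on the
    image, and the trace of a word against itself counts its rotational
    symmetries with a sign. *)
Lemma johnson_img f : (1 < k)%N -> andre k f -> img x (johnson x k f).
Proof.
move=> k_gt1 Af.
pose Tr w := projT1 (cid (word_trace_exists freeF k_gt1 w)).
have TrP w := projT2 (cid (word_trace_exists freeF k_gt1 w)).
apply: (img_of_traces freeF k_gt1 kn (Tr := Tr)) => [w|w _ [g Lg <-]|c w cw|c w u cu wu|w].
- by have [] := TrP w.
- by have [_ TrA _] := TrP w; apply: TrA; apply: (lcs_IA_andre (deg_gt0 k) Lg).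
- rewrite /Tr; have [_ _ ->] := TrP w; rewrite ?size_tuple // => /eqP.
  rewrite mulf_eq0 signr_eq0 /= => /eqP.
  (* The trivial rotation makes the sum positive. *)
  rewrite (bigD1 (Ordinal (deg_gt0 k))) //= eqxx.
  rewrite -natr_sum -natrD => /eqP; rewrite Num.Theory.pnatr_eq0.
  by [].
- rewrite /Tr; have [_ _ ->] := TrP w; rewrite ?size_tuple // big1 ?mulr0 // => j _.
  case: eqP => // uj; case/negP: wu.
  have -> : u = iter j (@rot1 n k) w by apply: val_inj; rewrite /= iter_rot1.
  exact: fconnect_iter.
by have [_ TrA _] := TrP w; apply: TrA.
Qed.

(** The integral form of surjectivity. *)
Lemma andre_lcs_mod f : andre k f ->
  exists2 g, lcs (@IA F) k g & andre k.+1 (g^-1 * f).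
Proof.
move=> Af; have [k_gt1|k_le1] := ltnP 1%N k; last first.
  (* In degree 1 both filtrations start with IA(F). *)
  have k1 : k = 1%N :> nat by apply/eqP; rewrite eqn_leq k_le1 deg_gt0.
  exists f; first by move: Af; rewrite k1.
  by rewrite mulVg; have [] := subgroup_andre F k.+1.
have [g Lg jg] := johnson_img k_gt1 Af; exists g => //.
have Ag := lcs_IA_andre (deg_gt0 k) Lg; have [_ AM AV] := subgroup_andre F k.
apply: (johnson_ker freeF); first by apply: AM => //; apply: AV.
by rewrite johnsonM ?johnsonV ?jg ?addNr //; apply: AV.
Qed.

Lemma UpsilonQ_surjective (y : grQ (andre_nseries F) k) :
  exists u : grQ (IA_nseries F) k, UpsilonQ F k u = y.
Proof.
move: y; apply: tens_ind => [|u q|u v [u' <-] [v' <-]].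
- by exists 0%R; rewrite linear0.
- move: u; apply: gr_ind => f Af; have [g Lg gf] := andre_lcs_mod Af.
  have Lg' : IA_nseries F k g by [].
  exists (tpure (gr_class Lg') q : grQ (IA_nseries F) k).
  rewrite -[UpsilonQ F k _]/(mapQ (Upsilon F k) _) mapQ_pure; congr tpure.
  by rewrite -[Upsilon F k _]/(gr_incl _ _) gr_inclE; apply/gr_classP.
by exists (u' + v')%R; rewrite linearD.
Qed.

End Surjectivity.

Section Generation.
Variable F : groupType.
Local Notation AN := (andre_nseries F).
Local Open Scope ring_scope.

Let S := lie_generated (homogeneous (A := AN) deg1).

Lemma lie_generated_subalgebra : lie_subalgebra S.
Proof.
rewrite /S /lie_generated; split.
- by move=> T [[]].
- by move=> u v Su Sv T sT; case: (sT) => -[_ TD _ _] _; apply: TD; [apply: Su|apply: Sv].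
- by move=> a u Su T sT; case: (sT) => -[_ _ TZ _] _; apply: TZ; apply: Su.
by move=> u v Su Sv T sT; case: (sT) => -[_ _ _ TB] _; apply: TB; [apply: Su|apply: Sv].
Qed.

(** The class of a commutator with an element of IA(F) is a Lie bracket with a
    class of degree 1. *)
Lemma lcs_IA_generated (k : nat) g (q : rat) : lcs (@IA F) k.+1 g ->
  S (dinj (tpure (cls AN (dS k) g) q : grQ AN (dS k))).
Proof.
have [S0 SD SZ SB] := lie_generated_subalgebra.
have base g' q' : S (dinj (tpure (cls AN deg1 g') q' : grQ AN deg1)).
  by apply: sub_gen_smallest; exists (tpure (cls AN deg1 g') q' : grQ AN deg1).
elim: k g q => [|k IH] g q; first by move=> _; apply: base.
have [tD _] := tpure_biadditive (gr AN (dS k.+1)) rat.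
suff sub : lcs (@IA F) k.+2 `<=` [set g | andre k.+2 g /\
    forall q, S (dinj (tpure (cls AN (dS k.+1) g) q : grQ AN (dS k.+1)))].
  by move=> /sub[].
have A1 := nterm1 AN (dS k.+1).
have c0 r : tpure (0 : gr AN (dS k.+1)) r = 0 :> grQ AN (dS k.+1).
  by apply: (addIr (tpure (0 : gr AN (dS k.+1)) r)); rewrite -tD !add0r.
apply: smallest_sub.
  split=> [|f h [Af Sf] [Ah Sh]|f [Af Sf]].
  - by split=> // r; rewrite cls1 c0 linear0.
  - split=> [|r]; first exact: (ntermM (A := AN) (k := dS k.+1)).
    rewrite (clsM (A := AN)) // tD linearD; apply: SD; [exact: Sf|exact: Sh].
  split=> [|r]; first exact: (ntermV (A := AN) (k := dS k.+1)).
  rewrite (clsV (A := AN)) // (biadditiveNl _ _ (tpure_biadditive _ _)).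
  by rewrite linearN -scaleN1r; apply: SZ; exact: Sf.
move=> _ [f [h [Lf Ah ->]]]; have Af : AN (dS k) f := lcs_IA_andre (ltn0Sn k) Lf.
have mE : dS k.+1 = addd (dS k) deg1 by apply: val_inj; rewrite /= addn1.
split=> [|r]; first by rewrite -[k.+2]/(deg (dS k.+1)) mE; exact: (nterm_addd (A := AN) (j := deg1) Af Ah).
rewrite mE; have := SB _ _ (IH f 1 Lf) (base h r); rewrite lie_br_dinj /grQ_br.
rewrite bilinQ_pure ?mul1r; last exact: gr_br_biadditive.
rewrite (clsE Af) (clsE (A := AN) (m := deg1) Ah) gr_brE.
by rewrite (clsE (nterm_addd Af (Ah : AN deg1 h))).
Qed.

Lemma UpsilonQ_generated (k : degree) (u : grQ (IA_nseries F) k) :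
  S (dinj (UpsilonQ F k u)).
Proof.
have [S0 SD SZ SB] := lie_generated_subalgebra.
move: u; apply: tens_ind => [|u q|u v Su Sv]; first by rewrite !linear0.
  move: u; apply: gr_ind => g Lg.
  rewrite -[UpsilonQ F k _]/(mapQ (Upsilon F k) _) mapQ_pure.
  rewrite -[Upsilon F k _]/(gr_incl _ _) gr_inclE -clsE.
  have kE : k = dS k.-1 by apply: val_inj; rewrite /= prednK // deg_gt0.
  by move: Lg; rewrite kE; apply: lcs_IA_generated.
by rewrite !linearD; apply: SD.
Qed.

End Generation.

Local Close Scope group_scope.

Theorem theorem5p1 (F : groupType) (n : nat) (freeF : free_of_rank F n) :
  (forall k : degree, (k + 2 <= n)%N ->
     forall y : grQ (andre_nseries F) k,
       exists x : grQ (IA_nseries F) k, UpsilonQ F k x = y) /\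
  (forall k : degree, (k + 2 <= n)%N ->
     homogeneous (A := andre_nseries F) k `<=`
       lie_generated (homogeneous (A := andre_nseries F) deg1)).
Proof.
have [x basisx] := freeF; split=> [k kn y|k kn _ [y _ <-]].
  exact: (UpsilonQ_surjective basisx kn).
have [u <-] := UpsilonQ_surjective basisx kn y.
exact: UpsilonQ_generated.
Qed.
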